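(* Let $G$ be a strictly ascending HNN-extension of a finitely generated non-abelian free group $F$ with respect to a non-surjective injective endomorphism $\varphi\colon F\to F$. Suppose that $A_1,\dots,A_s\leqslant G$ are subgroups with non-trivial centres. Then there exists an elliptic element of infinite order $f\in G$ such that for each $i=1,\dots,s$ the subgroup $\langle f,A_i\rangle\leqslant G$ is naturally isomorphic to the free product $\langle f\rangle*A_i$.
   Context: For a group $F$ and an injective endomorphism $\varphi\colon F\to F$, the ascending HNN-extension of $F$ with respect to $\varphi$ is the group $G=\langle F,t\mid tft^{-1}=\varphi(f)\text{ for all }f\in F\rangle$; it is called strictly ascending if $\varphi(F)$ is a proper subgroup of $F$. Let $\psi\colon G\to\mathbb{Z}$ be the homomorphism with $\psi(t)=1$ and $\psi(f)=0$ for all $f\in F$. An element $g\in G$ is called elliptic if $\psi(g)=0$ (equivalently, $g\in\bigcup_{n\ge 0}t^{-n}Ft^n$), and hyperbolic otherwise. For subgroups $H,K\leqslant G$, saying that $\langle H,K\rangle$ is naturally isomorphic to $H*K$ means that the homomorphism $H*K\to G$ extending the inclusions of $H$ and $K$ into $G$ is injective. *)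

(* Defs.v *)
From HB Require Import structures.
From mathcomp Require Import all_boot all_order all_algebra.
From mathcomp Require Import boolp.

Set Implicit Arguments.
Unset Strict Implicit.
Unset Printing Implicit Defensive.

Local Open Scope group_scope.
Local Open Scope quotient_scope.

(* Group presentations. A letter (x, b) stands for x if b = false and for     *)
(* x^-1 if b = true; a relation R u v imposes u = v.                          *)

Notation word X := (seq (X * bool)).

Section Presentation.
Variables (X : choiceType) (R : word X -> word X -> Prop).

Inductive word_cong : word X -> word X -> Prop :=
| WordRefl u : word_cong u u
| WordSym u v : word_cong u v -> word_cong v u
| WordTrans u v w : word_cong u v -> word_cong v w -> word_cong u w
| WordCat u u' v v' :
    word_cong u u' -> word_cong v v' -> word_cong (u ++ v) (u' ++ v')
| WordCancel x b : word_cong [:: (x, b); (x, ~~ b)] [::]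
| WordRel u v : R u v -> word_cong u v.

Definition word_eq (u v : word X) : bool := `[< word_cong u v >].

Lemma word_eq_refl : reflexive word_eq.
Proof. by move=> u; apply/asboolP; exact: WordRefl. Qed.

Lemma word_eq_sym : symmetric word_eq.
Proof. by move=> u v; apply/asboolP/asboolP; exact: WordSym. Qed.

Lemma word_eq_trans : transitive word_eq.
Proof.
by move=> v u w /asboolP uv /asboolP vw; apply/asboolP; exact: WordTrans vw.
Qed.

Canonical word_equiv := EquivRel word_eq word_eq_refl word_eq_sym word_eq_trans.

Definition presented := {eq_quot word_equiv}.
HB.instance Definition _ := Choice.on presented.

Definition pres_class (w : word X) : presented := \pi_presented w.

Lemma pres_classP (u v : word X) : pres_class u = pres_class v <-> word_cong u v.
Proof.
split=> [/eqP|uv]; first by rewrite /pres_class eqmodE => /asboolP.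
by apply/eqP; rewrite /pres_class eqmodE; apply/asboolP.
Qed.

Lemma pres_classK (q : presented) : pres_class (repr q) = q.
Proof. exact: reprK. Qed.

Definition word_inv (w : word X) : word X := rev [seq (a.1, ~~ a.2) | a <- w].

Lemma word_mulVw (w : word X) : word_cong (word_inv w ++ w) [::].
Proof.
elim: w => [|[x b] w IHw]; first exact: WordRefl.
rewrite /word_inv map_cons rev_cons -cats1 -catA.
apply: WordTrans IHw; apply: WordCat; first exact: WordRefl.
rewrite /= -[_ :: _ :: w]/([:: (x, ~~ b); (x, b)] ++ w).
rewrite -[X in word_cong _ X]/([::] ++ w).
apply: WordCat; last exact: WordRefl.
by rewrite -{2}[b]negbK; exact: WordCancel.
Qed.

Lemma word_invK : involutive word_inv.
Proof.
move=> w; rewrite /word_inv map_rev revK -map_comp -[RHS]map_id.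
by apply: eq_map => -[x b] /=; rewrite negbK.
Qed.

Lemma word_mulwV (w : word X) : word_cong (w ++ word_inv w) [::].
Proof. by have := word_mulVw (word_inv w); rewrite word_invK. Qed.

Definition pres_mul (p q : presented) : presented :=
  pres_class (repr p ++ repr q).
Definition pres_inv (p : presented) : presented :=
  pres_class (word_inv (repr p)).
Definition pres_one : presented := pres_class [::].

Lemma pres_repr (w : word X) : word_cong (repr (pres_class w)) w.
Proof. by apply/pres_classP; rewrite pres_classK. Qed.

Lemma pres_mulE (u v : word X) :
  pres_mul (pres_class u) (pres_class v) = pres_class (u ++ v).
Proof. by apply/pres_classP; apply: WordCat; exact: pres_repr. Qed.

Lemma pres_mulA : associative pres_mul.
Proof.
move=> p q r; rewrite -(pres_classK p) -(pres_classK q) -(pres_classK r).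
by rewrite !pres_mulE catA.
Qed.

Lemma pres_mul1 : left_id pres_one pres_mul.
Proof. by move=> p; rewrite -(pres_classK p) pres_mulE. Qed.

Lemma pres_mulr1 : right_id pres_one pres_mul.
Proof. by move=> p; rewrite -(pres_classK p) pres_mulE cats0. Qed.

Lemma pres_mulV : left_inverse pres_one pres_inv pres_mul.
Proof.
move=> p; rewrite -{2}(pres_classK p) pres_mulE.
by apply/pres_classP; exact: word_mulVw.
Qed.

Lemma pres_mulrV : right_inverse pres_one pres_inv pres_mul.
Proof.
move=> p; rewrite -{1}(pres_classK p) pres_mulE.
by apply/pres_classP; exact: word_mulwV.
Qed.

HB.instance Definition _ := isGroup.Build presented
  pres_mulA pres_mul1 pres_mulr1 pres_mulV pres_mulrV.

Definition pres_gen (x : X) : presented := pres_class [:: (x, false)].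

Section Lift.
Variables (G : groupType) (f : X -> G).

Definition word_eval (w : word X) : G :=
  \prod_(a <- w) (if a.2 then (f a.1)^-1 else f a.1).

(* Meaningful only if f satisfies the relations: it is then the homomorphism  *)
(* extending f (pres_lift_gen, pres_liftM).                                   *)
Definition pres_lift (q : presented) : G := word_eval (repr q).

Hypothesis fR : forall u v, R u v -> word_eval u = word_eval v.

Lemma word_eval_cong u v : word_cong u v -> word_eval u = word_eval v.
Proof.
elim=> {u v} [//|u v _ -> //|u v w _ -> _ -> //|||//].
- by move=> u u' v v' _ Eu _ Ev; rewrite /word_eval !big_cat /=; congr (_ * _).
- move=> x b; rewrite /word_eval !big_cons !big_nil mulg1 /=.
  by case: b; rewrite ?mulgV ?mulVg.
Qed.

Lemma pres_liftE w : pres_lift (pres_class w) = word_eval w.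
Proof. by apply: word_eval_cong; exact: pres_repr. Qed.

Lemma pres_lift_gen x : pres_lift (pres_gen x) = f x.
Proof. by rewrite pres_liftE /word_eval big_seq1. Qed.

Lemma pres_liftM : {morph pres_lift : p q / p * q}.
Proof.
move=> p q; rewrite -(pres_classK p) -(pres_classK q).
by rewrite [_ * _]pres_mulE !pres_liftE /word_eval big_cat.
Qed.

End Lift.
End Presentation.

(* Free groups: F is free if, for some family x : X -> F, the homomorphism    *)
(* from the group presented by X without relations to F extending x is        *)
(* bijective.                                                                 *)

Definition no_relation (X : choiceType) (u v : word X) : Prop := False.

Definition is_free_group (F : groupType) : Prop :=
  exists (X : choiceType) (x : X -> F),
    bijective (pres_lift x : presented (@no_relation X) -> F).

(* A subgroup is a groupClosed predicate; membership is boolean, which is no  *)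
(* restriction since every proposition is decidable here (boolp).             *)

Section Subgroups.
Variable G : groupType.
Implicit Types (S : groupClosed G) (B : {pred G}).

Definition generated B : {pred G} :=
  fun x => `[< forall S, {subset B <= S} -> x \in S >].

Lemma generatedP B x :
  reflect (forall S, {subset B <= S} -> x \in S) (x \in generated B).
Proof. exact: asboolP. Qed.

Lemma generated1 B : 1 \in generated B.
Proof. by apply/generatedP => S _; exact: gpred1. Qed.

Lemma generatedM B : mulg_closed (generated B).
Proof.
move=> x y /generatedP Bx /generatedP By; apply/generatedP => S BS.
by apply: gpredM; [exact: Bx | exact: By].
Qed.

Lemma generatedV B : invg_closed (generated B).
Proof.
move=> x /generatedP Bx; apply/generatedP => S BS.
by apply: gpredVr; exact: Bx.
Qed.

HB.instance Definition _ B := isMulClosed.Build G (generated B) (@generatedM B).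
HB.instance Definition _ B := isMul1Closed.Build G (generated B) (generated1 B).
HB.instance Definition _ B := isInvClosed.Build G (generated B) (@generatedV B).

Definition cyclic_subgroup (g : G) : groupClosed G :=
  GroupClosed.clone G (generated (pred1 g)) _.

Definition finitely_generated : Prop :=
  exists B : seq G, forall x, x \in generated (mem B).

Definition infinite_order (g : G) : Prop := forall n, 0 < n -> g ^+ n <> 1.

Definition nontrivial_centre S : Prop :=
  exists z, [/\ z \in S, z <> 1 & forall a, a \in S -> commute z a].

End Subgroups.

Section SubgroupType.
Variables (G : groupType) (S : groupClosed G).

Definition subgroup_type := {x : G | x \in S}.
HB.instance Definition _ := SubChoice.on subgroup_type.

Lemma subgroup_closed : group_closed (S : {pred G}).
Proof. by split=> [|x y Sx Sy]; [exact: gpred1 | exact: gpredM (gpredVr _ _)]. Qed.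

HB.instance Definition _ :=
  SubChoice_isSubGroup.Build G (fun x => x \in S) subgroup_type subgroup_closed.
End SubgroupType.

Section FreeProduct.
Variables H K : groupType.

Inductive free_prod_rel : word (H + K)%type -> word (H + K)%type -> Prop :=
| FreeProdL a b :
    free_prod_rel [:: (inl a, false); (inl b, false)] [:: (inl (a * b), false)]
| FreeProdR a b :
    free_prod_rel [:: (inr a, false); (inr b, false)] [:: (inr (a * b), false)].

Definition free_prod := presented free_prod_rel.
HB.instance Definition _ := Group.on free_prod.

Definition free_prod_inl (a : H) : free_prod := pres_gen _ (inl a).
Definition free_prod_inr (b : K) : free_prod := pres_gen _ (inr b).

Section Lift.
Variables (G : groupType) (f : {multiplicative H -> G}).
Variable (g : {multiplicative K -> G}).

Definition free_prod_copair (x : H + K) : G :=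
  match x with inl a => f a | inr b => g b end.

Definition free_prod_lift : free_prod -> G := pres_lift free_prod_copair.

Lemma free_prod_lift_rel u v : free_prod_rel u v ->
  word_eval free_prod_copair u = word_eval free_prod_copair v.
Proof.
by case=> a b; rewrite /word_eval !big_cons !big_nil /= !mulg1 gmulfM.
Qed.

Lemma free_prod_liftM : {morph free_prod_lift : p q / p * q}.
Proof. exact: pres_liftM free_prod_lift_rel. Qed.

Lemma free_prod_lift_inl a : free_prod_lift (free_prod_inl a) = f a.
Proof. exact: pres_lift_gen free_prod_lift_rel _. Qed.

Lemma free_prod_lift_inr b : free_prod_lift (free_prod_inr b) = g b.
Proof. exact: pres_lift_gen free_prod_lift_rel _. Qed.

End Lift.
End FreeProduct.

Definition natural_map (G : groupType) (H K : groupClosed G) :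
    free_prod (subgroup_type H) (subgroup_type K) -> G :=
  free_prod_lift (val : subgroup_type H -> G) (val : subgroup_type K -> G).

(* "<H, K> is naturally isomorphic to H * K": the homomorphism from H * K to  *)
(* G extending both inclusions is injective.                                  *)
Definition naturally_free_product (G : groupType) (H K : groupClosed G) : Prop :=
  injective (@natural_map G H K).

(* The multiplicative copy of the additive group of the integers. *)
Definition infinite_cyclic := int.
HB.instance Definition _ := Choice.on infinite_cyclic.
HB.instance Definition _ := isGroup.Build infinite_cyclic
  (@GRing.addrA int) (@GRing.add0r int) (@GRing.addr0 int)
  (@GRing.addNr int) (@GRing.addrN int).

Section HNN.
Variables (F : groupType) (phi : {multiplicative F -> F}).

(* The generator inr tt is the stable letter t. *)
Inductive hnn_rel : word (F + unit)%type -> word (F + unit)%type -> Prop :=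
| HNNMul a b :
    hnn_rel [:: (inl a, false); (inl b, false)] [:: (inl (a * b), false)]
| HNNConj a :
    hnn_rel [:: (inr tt, false); (inl a, false); (inr tt, true)]
            [:: (inl (phi a), false)].

Definition hnn := presented hnn_rel.
HB.instance Definition _ := Group.on hnn.

Definition hnn_base (a : F) : hnn := pres_gen _ (inl a).
Definition hnn_stable : hnn := pres_gen _ (inr tt).

Lemma hnn_baseM : {morph hnn_base : a b / a * b}.
Proof.
move=> a b; rewrite [RHS]pres_mulE; apply/pres_classP/WordSym/WordRel.
exact: HNNMul.
Qed.

Lemma hnn_conj a : hnn_stable * hnn_base a * hnn_stable^-1 = hnn_base (phi a).
Proof.
have -> : hnn_stable^-1 = pres_class _ [:: (inr tt, true)].
  apply: (mulgI hnn_stable); rewrite mulgV [RHS]pres_mulE.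
  by apply/pres_classP/WordSym; exact: (WordCancel _ _ false).
rewrite [X in X * _]pres_mulE [LHS]pres_mulE.
by apply/pres_classP/WordRel; exact: HNNConj.
Qed.

Definition hnn_psi_gen (x : F + unit) : infinite_cyclic :=
  match x with inl _ => 0%R | inr _ => 1%R end.

Definition hnn_psi : hnn -> int := pres_lift hnn_psi_gen.

Lemma hnn_psi_rel u v : hnn_rel u v ->
  word_eval hnn_psi_gen u = word_eval hnn_psi_gen v.
Proof. by case=> *; rewrite /word_eval !big_cons !big_nil. Qed.

Lemma hnn_psiM x y : hnn_psi (x * y) = (hnn_psi x + hnn_psi y)%R.
Proof. exact: (pres_liftM hnn_psi_rel). Qed.

Lemma hnn_psi_base a : hnn_psi (hnn_base a) = 0%R.
Proof. exact: (pres_lift_gen hnn_psi_rel). Qed.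

Lemma hnn_psi_stable : hnn_psi hnn_stable = 1%R.
Proof. exact: (pres_lift_gen hnn_psi_rel). Qed.

Definition elliptic (g : hnn) : Prop := hnn_psi g = 0%R.

End HNN.

(* Main.v *)
Require Import Defs.
From HB Require Import structures.
From mathcomp Require Import all_boot all_order all_algebra perm zify.
From mathcomp Require Import boolp.

(* Conjugating by a power of t, we may assume that all relevant elements lie in
   F or in F t^m with m > 0. The subgroup A_i is of one of two kinds.

   If A_i contains hyperbolic elements, one of them commutes with the elliptic
   part P of A_i, so that P lies in F; if h in A_i has minimal positive psi,
   then P lies in H_i = h F h^-1, a subgroup of F of infinite index, since it is
   proper and generated by rank(F) elements (Schreier). An element f of F with
   <f, H_i> = <f> * H_i then satisfies <f, A_i> = <f> * A_i: of the A_i-conjugates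
   of f that occur in an alternating word, those of higher level lie in H_i.

   If A_i is elliptic, it is locally cyclic, and it suffices that f does not
   commute with a central element z_i of A_i, because two elements of a free
   group that do not commute are a free basis of the subgroup they generate.
   This follows from <f, H_i> = <f> * H_i with H_i = <z_i>.

   An element f of F that works for all H_i is f = u c u^-1, with u a positive
   word leaving the (finite) core of each Schreier graph H_i \ F, and c a
   generator other than the last letter of u: f plays ping-pong with all the H_i
   on the set of reduced words that start with u. *)

Set Implicit Arguments.
Unset Strict Implicit.
Unset Printing Implicit Defensive.

Local Open Scope group_scope.

(** * Reduced words in free groups *)

(** Two obstacles shape the argument. An elliptic A_i need not lie in a single conjugate t^-n F t^n;
    only finitely many of its elements can be moved into F at once, so freeness is checked for one
    alternating word at a time. If A_i has hyperbolic elements, the conjugates of f in an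
    alternating word need not lie in F; but conjugation by elements of A_i with positive psi maps F
    into H_i, so a left translation that makes the least value of psi equal to 0 puts them all in F.

    Infinite index of H_i matters because only then does the core differ from the whole Schreier
    graph. A subgroup of finite index j in a free group of rank r > 1 has rank 1 + j(r - 1), which
    exceeds r unless j = 1. *)

Section Morph.
Variables (G H : groupType) (f : G -> H).
Hypothesis fM : {morph f : x y / x * y}.

Lemma morph1 : f 1 = 1.
Proof. by apply: (@mulgI _ (f 1)); rewrite -fM !mulg1. Qed.

Lemma morphV x : f x^-1 = (f x)^-1.
Proof. by apply: (@mulgI _ (f x)); rewrite -fM !mulgV morph1. Qed.

Lemma morphX x n : f (x ^+ n) = f x ^+ n.
Proof. by elim: n => [|n IH]; rewrite ?morph1 // !expgS fM IH. Qed.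

Lemma morph_inj : (forall x, f x = 1 -> x = 1) -> injective f.
Proof. by move=> K x y E; apply/divg1_eq/K; rewrite fM morphV E mulgV. Qed.

Lemma morph_word_eval (X : choiceType) (x : X -> G) (w : word X) :
  f (word_eval x w) = word_eval (f \o x) w.
Proof.
rewrite /word_eval (big_morph f fM morph1); apply: eq_bigr => a _.
by case: a.2; rewrite ?morphV.
Qed.

End Morph.

Section Words.
Variable X : choiceType.
Implicit Types (a : X * bool) (u v w : word X).

Definition linv a := (a.1, ~~ a.2).

Lemma linvK : involutive linv.
Proof. by case=> y b; rewrite /linv /= negbK. Qed.

Lemma linv_neq a : linv a != a.
Proof. by case: a => y []; rewrite /linv /= xpair_eqE andbF. Qed.

Definition reduced w := sorted (fun a b => b != linv a) w.

Definition push a w :=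
  if w is b :: w' then if b == linv a then w' else a :: w else [:: a].

Definition reduce w := foldr push [::] w.

Lemma reduced_catl u v : reduced (u ++ v) -> reduced u.
Proof. by case: u => //= a u; rewrite /reduced /= cat_path => /andP[]. Qed.

Lemma reduced_cat2 u a b v :
  reduced (rcons u a ++ b :: v) =
  [&& reduced (rcons u a), b != linv a & reduced (b :: v)].
Proof.
rewrite /reduced; case: u => [|c u] //=.
by rewrite cat_path /= last_rcons.
Qed.

Lemma push_reduced a w : reduced w -> reduced (push a w).
Proof.
case: w => [|b w] //=; case: eqP => [_|/eqP ne]; first exact: path_sorted.
by rewrite /reduced /= => ->; rewrite ne.
Qed.

Lemma pushVK a w : reduced w -> push a (push (linv a) w) = w.
Proof.
case: w => [|b w] /=; first by rewrite eqxx.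
rewrite linvK; case: eqP => [->|_] /=; last by rewrite eqxx.
case: w => [|c w] //=; rewrite /reduced /= => /andP[+ _].
by case: eqP.
Qed.

Lemma reduce_reduced w : reduced (reduce w).
Proof. by elim: w => //= a w; exact: push_reduced. Qed.

Lemma reduced_id w : reduced w -> reduce w = w.
Proof.
elim: w => //= a w IH rw; rewrite IH; last exact: path_sorted rw.
by case: w rw {IH} => //= b w; rewrite /reduced /=; case: eqP.
Qed.

(** Van der Waerden's argument: letters act on the reduced words by mutually inverse maps, so
    congruent words act alike; the value at the empty word is [reduce]. *)
Lemma reduce_cong u v : word_cong (@no_relation X) u v -> reduce u = reduce v.
Proof.
move=> uv; rewrite /reduce.
suff : forall w, reduced w -> foldr push w u = foldr push w v by apply.
have red w z : reduced w -> reduced (foldr push w z).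
  by move=> rw; elim: z => //= a z; exact: push_reduced.
elim: uv => {u v} [//|u v _ IH w rw|u v w _ IH1 _ IH2 z rz||y b w rw|//].
- by rewrite IH.
- by rewrite IH1 ?IH2.
- by move=> u u' v v' _ IH1 _ IH2 w rw; rewrite !foldr_cat IH2 // IH1 ?red.
- exact: (pushVK (y, b)).
Qed.

Lemma word_inv_cat u v : word_inv (u ++ v) = word_inv v ++ word_inv u.
Proof. by rewrite /word_inv map_cat rev_cat. Qed.

Lemma word_inv_rcons u a : word_inv (rcons u a) = linv a :: word_inv u.
Proof. by rewrite /word_inv map_rcons rev_rcons. Qed.

Lemma word_inv_cons u a : word_inv (a :: u) = rcons (word_inv u) (linv a).
Proof. by rewrite /word_inv map_cons rev_cons. Qed.

Lemma size_word_inv u : size (word_inv u) = size u.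
Proof. by rewrite /word_inv size_rev size_map. Qed.

Lemma reduced_inv u : reduced u -> reduced (word_inv u).
Proof.
rewrite /reduced /word_inv rev_sorted sorted_map; apply: sub_sorted => a b /=.
by rewrite /linv /= !xpair_eqE; case: b a => [b []] [a []]; rewrite /= eq_sym.
Qed.

Lemma reduced_cancel u v : reduced u -> reduced v ->
  exists p q r, [/\ u = p ++ q, v = word_inv q ++ r & reduced (p ++ r)].
Proof.
elim/last_ind: u v => [|u l IH] v ru rv; first by exists [::], [::], v.
case: v rv => [|m v] rv; first by exists (rcons u l), [::], [::]; rewrite cats0.
case: (eqVneq m (linv l)) => [Em|ne]; last first.
  exists (rcons u l), [::], (m :: v); split; rewrite ?cats0 //.
  by rewrite reduced_cat2 ru ne rv.
have ru' : reduced u by move: ru; rewrite -cats1; exact: reduced_catl.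
have rv' : reduced v by exact: path_sorted rv.
have [p [q [r [Eu Ev rpr]]]] := IH _ ru' rv'.
exists p, (rcons q l), r; split=> //; first by rewrite Eu rcons_cat.
by rewrite word_inv_rcons Ev Em.
Qed.

End Words.

Section Evaluation.
Variables (X : choiceType) (G : groupType) (f : X -> G).

Lemma word_eval_cat u v : word_eval f (u ++ v) = word_eval f u * word_eval f v.
Proof. by rewrite /word_eval big_cat. Qed.

Lemma word_eval_cons a u : word_eval f (a :: u) = word_eval f [:: a] * word_eval f u.
Proof. by rewrite -word_eval_cat. Qed.

Lemma word_eval_cong0 u v :
  word_cong (@no_relation X) u v -> word_eval f u = word_eval f v.
Proof. exact: word_eval_cong. Qed.

Lemma word_eval0 : word_eval f [::] = 1.
Proof. by rewrite /word_eval big_nil. Qed.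

Lemma word_eval1 a : word_eval f [:: a] = if a.2 then (f a.1)^-1 else f a.1.
Proof. by rewrite /word_eval big_seq1. Qed.

Lemma word_evalV u : word_eval f (word_inv u) = (word_eval f u)^-1.
Proof.
apply: (@mulIg _ (word_eval f u)); rewrite mulVg -word_eval_cat -word_eval0.
exact/word_eval_cong0/word_mulVw.
Qed.

Lemma word_eval_reduce u : word_eval f (reduce u) = word_eval f u.
Proof.
elim: u => //= a u IH; rewrite word_eval_cons -IH; case: (reduce u) => [|b v] /=.
  by rewrite word_eval0 mulg1.
case: eqP => [->|_]; last by rewrite -word_eval_cons.
rewrite (word_eval_cons (linv a) v) mulgA !word_eval1 /=.
by case: (a.2); rewrite /= ?mulgV ?mulVg mul1g.
Qed.

End Evaluation.

Section ReducedForm.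
Variables (X : choiceType) (F : groupType) (x : X -> F).
Hypothesis x_basis : bijective (pres_lift x : presented (@no_relation X) -> F).
Implicit Types (g h : F).

Local Notation ev := (word_eval x).

Lemma basis_rep g : exists w, (reduced w && (ev w == g)).
Proof.
case: x_basis => r _ rK; exists (reduce (repr (r g))).
by rewrite reduce_reduced word_eval_reduce -[eqbLHS]/(pres_lift x (r g)) rK eqxx.
Qed.

Definition nform g : word X := xchoose (basis_rep g).

Lemma redK g : ev (nform g) = g.
Proof. by have /andP[_ /eqP] := xchooseP (basis_rep g). Qed.

Lemma red_reduced g : reduced (nform g).
Proof. by have /andP[] := xchooseP (basis_rep g). Qed.

Lemma ev_cong u v : ev u = ev v -> word_cong (@no_relation X) u v.
Proof.
by move=> uv; apply/pres_classP; apply: (bij_inj x_basis); rewrite !pres_liftE.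
Qed.

Lemma ev_inj u v : reduced u -> reduced v -> ev u = ev v -> u = v.
Proof.
by move=> ru rv /ev_cong/reduce_cong; rewrite !reduced_id.
Qed.

Lemma red_ev w : reduced w -> nform (ev w) = w.
Proof. by move=> rw; apply: ev_inj => //; rewrite ?red_reduced ?redK. Qed.

Lemma red1 : nform 1 = [::].
Proof. by rewrite -(word_eval0 x) red_ev. Qed.

Lemma red_eq0 g : nform g = [::] -> g = 1.
Proof. by move=> E; rewrite -(redK g) E word_eval0. Qed.

Lemma redV g : nform g^-1 = word_inv (nform g).
Proof. by rewrite -{1}(redK g) -word_evalV red_ev // reduced_inv ?red_reduced. Qed.

(** [b] is the part that cancels; the cancellation arguments below start from this decomposition. *)
Lemma redM g h : exists a b c,
  [/\ nform g = a ++ b, nform h = word_inv b ++ c & nform (g * h) = a ++ c].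
Proof.
have [a [b [c [Eg Eh rac]]]] := reduced_cancel (red_reduced g) (red_reduced h).
exists a, b, c; split=> //; apply: (ev_inj (red_reduced _) rac).
by rewrite redK -{1}(redK g) -{1}(redK h) Eg Eh !word_eval_cat word_evalV !gnorm.
Qed.

End ReducedForm.

(** * The core of a finitely generated subgroup and the Schreier bound *)

Section Span.
Variables (G : groupType) (B : seq G).

Inductive span : G -> Prop :=
| span1 : span 1
| span_consM b g : b \in B -> span g -> span (b * g)
| span_consV b g : b \in B -> span g -> span (b^-1 * g).

Lemma span_mem b : b \in B -> span b.
Proof. by move=> Bb; rewrite -[b]mulg1; apply: span_consM => //; exact: span1. Qed.

Lemma spanM g h : span g -> span h -> span (g * h).
Proof.
elim=> {g} [|b g Bb _ IH|b g Bb _ IH] Sh; rewrite ?mul1g // -mulgA.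
  by apply: span_consM => //; exact: IH.
by apply: span_consV => //; exact: IH.
Qed.

Lemma spanV g : span g -> span g^-1.
Proof.
elim=> {g} [|b g Bb _ IH|b g Bb _ IH]; rewrite ?invg1 ?invgM; first exact: span1.
  by apply: spanM => //; rewrite -[b^-1]mulg1; apply: span_consV => //; exact: span1.
by apply: spanM => //; rewrite invgK; exact: span_mem.
Qed.

End Span.

Section Core.
Variables (X : choiceType) (F : groupType) (x : X -> F).
Hypothesis x_basis : bijective (pres_lift x : presented (@no_relation X) -> F).
Local Notation ev := (word_eval x).
Local Notation red := (nform x_basis).
Variable B : seq F.
Implicit Types (g h : F) (p q u w : word X).

(* The cosets (span B) g with g covered are the vertices of a finite connected *)
(* subgraph of the Schreier graph carrying all reduced loops at the base point. *)
Definition core_reps : seq F :=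
  1 :: flatten [seq [seq ev (take n (red b)) | n <- iota 0 (size (red b)).+1]
               | b <- B].

Definition covered g := exists2 k, k \in core_reps & span B (g * k^-1).

Lemma covered1 : covered 1.
Proof. by exists 1; rewrite ?mem_head // mulgV; exact: span1. Qed.

Lemma covered_mull h g : span B h -> covered g -> covered (h * g).
Proof. by move=> Sh [k kk Sg]; exists k => //; rewrite -mulgA; exact: spanM. Qed.

Let core h := forall p, prefix p (red h) -> covered (ev p).

Lemma core_mem b : b \in B -> core b.
Proof.
move=> Bb p; rewrite prefixE => /eqP Ep; exists (ev p); last first.
  by rewrite mulgV; exact: span1.
rewrite inE; apply/orP; right; apply/flatten_mapP; exists b => //.
apply/mapP; exists (size p); last by rewrite Ep.
by rewrite mem_iota /= add0n ltnS -Ep size_take; case: ltnP => // /ltnW.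
Qed.

(** A prefix reaching beyond [a] is [h] times a prefix of the normal form of [g], hence ends at the
    same vertex of the Schreier graph as that prefix. *)
Lemma core_mul h g : span B h -> core h -> core g -> core (h * g).
Proof.
have [a [b [c [Eh Eg E]]]] := redM x_basis h g.
move=> Sh Ch Cg p; rewrite E => pac; case: (leqP (size p) (size a)) => [le|/ltnW ge].
  apply: Ch; rewrite Eh prefixE take_cat.
  move: pac; rewrite prefixE take_cat; case: ltngtP le => // ->.
  by rewrite !subnn !take0.
have [c' Ec] : exists c', p = a ++ c'.
  move: pac; rewrite prefixE take_cat ltnNge ge /= => /eqP <-.
  by exists (take (size p - size a) c).
have pc : prefix c' c by move: pac; rewrite Ec prefix_catr // eqxx.
have -> : ev p = h * ev (word_inv b ++ c').
  rewrite -(redK x_basis h) Eh Ec !word_eval_cat word_evalV.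
  by rewrite !gnorm.
by apply: covered_mull => //; apply: Cg; rewrite Eg prefix_catr // eqxx.
Qed.

Lemma core_inv h : span B h -> core h -> core h^-1.
Proof.
move=> Sh Ch p; rewrite redV => /prefixP[q Eq].
have Eh : red h = word_inv q ++ word_inv p.
  by rewrite -word_inv_cat -Eq word_invK.
have -> : ev p = h^-1 * ev (word_inv q).
  rewrite -[h in h^-1](redK x_basis) Eh word_eval_cat !word_evalV.
  by rewrite !gnorm.
by apply: covered_mull (spanV Sh) _; apply: Ch; rewrite Eh prefix_prefix.
Qed.

Lemma span_core h p : span B h -> prefix p (red h) -> covered (ev p).
Proof.
move=> Sh; have [_ +] : span B h /\ core h; last by apply.
elim: Sh => {h} [|b g Bb Sg [_ Cg]|b g Bb Sg [_ Cg]].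
- split; first exact: span1.
  by move=> {}p; rewrite red1 prefixs0 => /eqP->; rewrite word_eval0; exact: covered1.
- split; first exact: span_consM.
  by apply: core_mul => //; [exact: span_mem | exact: core_mem].
- split; first exact: span_consV.
  have Sb := span_mem Bb; apply: core_mul => //; first exact: spanV.
  by apply: core_inv => //; exact: core_mem.
Qed.

Lemma prefix_cat_split q u w : prefix q (u ++ w) ->
  prefix q u \/ exists2 q', q = u ++ q' & prefix q' w.
Proof.
elim: u q => [|a u IH] q; first by move=> qw; right; exists q.
case: q => [|b q]; first by left.
rewrite cat_cons !prefix_cons => /andP[/eqP-> /IH[qu|[q' -> qw]]].
  by left; rewrite eqxx.
by right; exists q'.
Qed.

Lemma prefix_comparable u w q : prefix u q -> prefix w q -> size u <= size w ->
  prefix u w.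
Proof.
rewrite !prefixE => /eqP Eu /eqP Ew le.
by apply/eqP; rewrite -{1}Ew take_takel.
Qed.

(** Both [a] and [word_inv b] are initial parts of reduced loops, so they stay in the core and [q]
    extends each of them: [q = word_inv b ++ q1 = a ++ q2]. If the remainders differed in length,
    the end of [q] would be the same vertex as that of a proper prefix of [q], which is covered. So
    [a] is [word_inv b] and [h] is trivial. *)
Lemma exit_disjoint q h g :
  ~ covered (ev q) -> (forall p, prefix p q -> p != q -> covered (ev p)) ->
  span B h -> prefix q (red g) -> prefix q (red (h * g)) -> h = 1.
Proof.
move=> nq cq Sh; have [a [b [c [Eh -> ->]]]] := redM x_basis h g.
have ca : ~~ prefix q a.
  apply/negP => qa; apply/nq/(span_core Sh).
  by rewrite Eh; exact: prefix_catl.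
have cb : ~~ prefix q (word_inv b).
  apply/negP => qb; apply/nq/(span_core (spanV Sh)).
  by rewrite redV Eh word_inv_cat; exact: prefix_catl.
move=> /prefix_cat_split[|[q1 E1 p1]]; first by rewrite (negbTE cb).
move=> /prefix_cat_split[|[q2 E2 p2]]; first by rewrite (negbTE ca).
have hE : h = ev a * ev b by rewrite -word_eval_cat -Eh redK.
have Sz : size q = size b + size q1 by rewrite E1 size_cat size_word_inv.
have Sz2 : size q = size a + size q2 by rewrite E2 size_cat.
case: (ltngtP (size q1) (size q2)) => [lt|lt|eq].
- have pq : prefix (a ++ q1) q.
    by rewrite E2 prefix_catr // eqxx /=; exact: prefix_comparable p1 p2 (ltnW lt).
  have ne : a ++ q1 != q by rewrite E2 eqseq_cat // eqxx; case: eqP lt => // ->; rewrite ltnn.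
  case: nq; rewrite E1.
  have -> : ev (word_inv b ++ q1) = h^-1 * ev (a ++ q1).
    by rewrite hE !word_eval_cat word_evalV !gnorm.
  by apply: covered_mull (spanV Sh) _; exact: cq.
- have pq : prefix (word_inv b ++ q2) q.
    by rewrite E1 prefix_catr // eqxx /=; exact: prefix_comparable p2 p1 (ltnW lt).
  have ne : word_inv b ++ q2 != q.
    by rewrite E1 eqseq_cat // eqxx; case: eqP lt => // ->; rewrite ltnn.
  case: nq; rewrite E2.
  have -> : ev (a ++ q2) = h * ev (word_inv b ++ q2).
    by rewrite hE !word_eval_cat word_evalV !gnorm.
  by apply: covered_mull Sh _; exact: cq.
- have Ea : word_inv b = a.
    have/eqP: word_inv b ++ q1 = a ++ q2 by rewrite -E1 -E2.
    rewrite eqseq_cat; first by case/andP => /eqP.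
    by rewrite size_word_inv; apply/eqP; rewrite -(eqn_add2r (size q1)) -Sz Sz2 eq.
  by rewrite hE -Ea word_evalV mulVg.
Qed.

End Core.

(** * Counting Z/2-labellings of a finite Schreier graph *)

Section Counting.
Variables (X : choiceType) (F : groupType) (x : X -> F).
Hypothesis x_basis : bijective (pres_lift x : presented (@no_relation X) -> F).
Local Notation ev := (word_eval x).
Variables (xs : seq X) (B ks : seq F).
Hypotheses (xs_uniq : uniq xs) (xs_all : forall y, y \in xs).
Hypothesis cover : forall g, exists2 k, k \in ks & span B (g * k^-1).

Let same (g h : F) := `[< span B (g * h^-1) >].

Let sameP g h : reflect (span B (g * h^-1)) (same g h).
Proof. exact: asboolP. Qed.

Let same_mulr g h k : same (g * k) (h * k) = same g h.
Proof. by rewrite /same invgM -!mulgA mulVKg. Qed.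

Let rep g := nth 1 ks (find (same g) ks).

Let rep_lt g : has (same g) ks.
Proof. by apply/hasP; have [k kk Sk] := cover g; exists k => //; exact/sameP. Qed.

Let rep_same g : same g (rep g).
Proof. exact: nth_find. Qed.

Let rep_ks g : rep g \in ks.
Proof. by rewrite mem_nth // -has_find. Qed.

Let rep_eq g h : (rep g == rep h) = same g h.
Proof.
apply/eqP/idP => [E|/sameP gh].
  apply/sameP; have /sameP Sg := rep_same g; have /sameP Sh := rep_same h.
  by have := spanM Sg (spanV Sh); rewrite E !gnorm.
rewrite /rep; congr (nth 1 ks _); apply: eq_find => k.
apply/sameP/sameP => S; last by have := spanM gh S; rewrite !gnorm.
by have := spanM (spanV gh) S; rewrite !gnorm.
Qed.

Let rs := undup (map rep ks).
Let J : finType := seq_sub rs.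

Let rep_rep g : rep (rep g) = rep g.
Proof. by apply/eqP; rewrite eq_sym rep_eq. Qed.

Let rep_rs g : rep g \in rs.
Proof. by rewrite mem_undup -rep_rep; apply: map_f. Qed.

Let st g : J := SeqSub (rep_rs g).

Let st_eq g h : (st g == st h) = same g h.
Proof. by rewrite -rep_eq -val_eqE. Qed.

Let st_val (j : J) : st (val j) = j.
Proof.
apply/val_inj => /=; have := valP j; rewrite mem_undup => /mapP[k _ ->].
exact: rep_rep.
Qed.

Let st_mul g h : st (val (st g) * h) = st (g * h).
Proof.
by apply/eqP; rewrite st_eq same_mulr -st_eq st_val.
Qed.

Let T : finType := seq_sub xs.
Let letter (y : X) : T := SeqSub (xs_all y).
Let label := {ffun T * J -> bool}.

Section Cover.
Variable l : label.

(** A labelling of the edges defines a two-sheeted cover of the Schreier graph: the letter [y] moves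
    along its edge and changes sheet if the label is [true]. *)
Let step_fun (y : X) (z : J * bool) : J * bool :=
  (st (val z.1 * x y), z.2 (+) l (letter y, z.1)).

Let step_inj y : injective (step_fun y).
Proof.
move=> [i b] [j c] [/eqP E1 E2].
have Eij : i = j.
  by apply/eqP; move: E1; rewrite rep_eq same_mulr -st_eq !st_val.
by subst j; move/addIb: E2 => ->.
Qed.

Definition cover_step y : {perm J * bool} := perm (@step_inj y).

Definition cover_act g := word_eval cover_step (nform x_basis g).

Lemma act_ev w : cover_act (ev w) = word_eval cover_step w.
Proof. by apply: word_eval_cong0; apply: (ev_cong x_basis); rewrite redK. Qed.

Lemma actM g h : cover_act (g * h) = cover_act g * cover_act h.
Proof.
by rewrite -(redK x_basis g) -(redK x_basis h) -word_eval_cat !act_ev word_eval_cat.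
Qed.

Lemma actV g : cover_act g^-1 = (cover_act g)^-1.
Proof. exact: morphV actM g. Qed.

Lemma act_letter y : cover_act (x y) = cover_step y.
Proof.
have -> : x y = ev [:: (y, false)] by rewrite word_eval1.
by rewrite act_ev word_eval1.
Qed.

Lemma act_state g z : (cover_act g z).1 = st (val z.1 * g).
Proof.
rewrite -(redK x_basis g) act_ev; move: (nform x_basis g) => w.
elim: w z => [|[y b] w IH] z.
  by rewrite !word_eval0 perm1 mulg1 st_val.
rewrite !(word_eval_cons _ (y, b) w) permM IH mulgA -[RHS]st_mul; congr st.
congr (val _ * _); rewrite !word_eval1 /=; case: b => /=; last by rewrite permE.
rewrite -{2}[z](permKV (cover_step y)) [in RHS]permE /= st_mul mulgK st_val.
by [].
Qed.

Lemma act_flip g z : cover_act g (z.1, ~~ z.2) = ((cover_act g z).1, ~~ (cover_act g z).2).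
Proof.
have fs y (t : J * bool) : cover_step y (t.1, ~~ t.2) = ((cover_step y t).1, ~~ (cover_step y t).2).
  by rewrite !permE /step_fun /= addNb.
rewrite -(redK x_basis g) act_ev; move: (nform x_basis g) => w.
elim: w z => [|[y b] w IH] z; first by rewrite !word_eval0 !perm1.
rewrite !(word_eval_cons _ (y, b) w) !permM -IH; congr (word_eval cover_step w _).
rewrite !word_eval1 /=; case: b => //=.
by apply: (canLR (permK _)); rewrite fs permKV.
Qed.

End Cover.

Let base : J := st 1.

Section Agree.
Variables l m : label.

Definition agree g := forall b, cover_act l g (base, b) = cover_act m g (base, b).

Lemma agreeP g : (cover_act l g (base, false)).2 = (cover_act m g (base, false)).2 -> agree g.
Proof.
move=> E b; have E0 : cover_act l g (base, false) = cover_act m g (base, false).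
  rewrite [LHS]surjective_pairing [RHS]surjective_pairing.
  by rewrite E !act_state.
case: b => //; have := act_flip l g (base, false).
by have := act_flip m g (base, false); rewrite /= E0 => -> ->.
Qed.

Let base_span g : span B g -> st (val base * g) = base.
Proof.
move=> Sg; rewrite st_mul mul1g; apply/eqP; rewrite st_eq.
by apply/sameP; rewrite invg1 mulg1.
Qed.

Let agreeM g h : span B g -> agree g -> agree h -> agree (g * h).
Proof.
move=> Sg Ag Ah b; rewrite !actM !permM -Ag.
have -> : cover_act l g (base, b) = (base, (cover_act l g (base, b)).2).
  by rewrite {1}[cover_act l g _]surjective_pairing act_state base_span.
exact: Ah.
Qed.

Let agreeV g : span B g -> agree g -> agree g^-1.
Proof.
move=> Sg Ag b; rewrite !actV; apply: (canRL (permK _)).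
have E : (cover_act l g)^-1 (base, b) = (base, ((cover_act l g)^-1 (base, b)).2).
  rewrite {1}[(cover_act l g)^-1 _]surjective_pairing -actV act_state base_span //.
  exact: spanV.
by rewrite E -Ag -E permKV.
Qed.

Let agree_span g : (forall b, b \in B -> agree b) -> span B g -> agree g.
Proof.
move=> AB; elim=> {g} [|b g Bb Sg IH|b g Bb Sg IH].
- by move=> b; rewrite /cover_act red1 !word_eval0.
- by apply: agreeM => //; [exact: span_mem | exact: AB].
- have Sb := span_mem Bb; apply: agreeM => //; first exact: spanV.
  by apply: agreeV => //; exact: AB.
Qed.

(** Agreement on [B] extends to [span B], and every element is one of [span B] times a coset
    representative, so the two actions agree on the fibre over the base point. The label of an edge
    is recovered by comparing the sheets at its two ends. *)
Lemma label_eq : (forall b, b \in B -> agree b) ->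
  (forall j : J, j != base -> agree (val j)) -> l = m.
Proof.
move=> AB AJ.
have AJ' (j : J) : agree (val j).
  case: (eqVneq j base) => [->|]; last exact: AJ.
  apply: agree_span => //; have /sameP := rep_same 1.
  by rewrite mul1g => /spanV; rewrite invgK.
have A g : agree g.
  have /sameP Sg := rep_same g; rewrite -[g](mulgVK (rep g)).
  by apply: agreeM => //; [exact: agree_span | exact: (AJ' (st g))].
apply/ffunP => -[t j].
have [y Ey] : exists y, t = letter y.
  by exists (val t); apply/val_inj.
have Ej n : (cover_act n (val j) (base, false)).1 = j.
  by rewrite act_state st_mul mul1g st_val.
have := A (val j * x y) false; rewrite !actM !permM -(AJ' j) !act_letter !permE.
by case=> /addbI; rewrite Ej Ey.
Qed.

End Agree.

(* The labellings of the edges of the Schreier graph by Z/2 are the derivations *)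
(* of F; one that vanishes on the subgroup is principal.                        *)
Lemma schreier_bound : size B <= size xs -> 1 < size xs -> forall g, span B g.
Proof.
move=> leB gt1.
(* A labelling is determined by one bit for each generator and one for each vertex other than the
   base point. *)
pose Phi (l : label) : {ffun 'I_(size B) -> bool} * {ffun {j : J | j != base} -> bool} :=
  ([ffun i => (cover_act l (tnth (in_tuple B) i) (base, false)).2],
   [ffun j => (cover_act l (val (val j)) (base, false)).2]).
have Phi_inj : injective Phi.
  move=> l m [/ffunP E1 /ffunP E2]; apply: label_eq.
    move=> b Bb; have [i ->] : exists i, b = tnth (in_tuple B) i by apply/tnthP.
    by have := E1 i; rewrite !ffunE; exact: agreeP.
  by move=> j nj; have := E2 (exist _ j nj); rewrite !ffunE; exact: agreeP.
have := leq_card _ Phi_inj; rewrite card_prod !card_ffun card_prod card_ord card_bool.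
rewrite card_sig.
have -> : #|[pred j : J | j != base]| = #|J|.-1 by exact: cardC1.
rewrite card_seq_sub // -expnD leq_exp2l // => le.
have J_gt0 : 0 < #|J| by apply/card_gt0P; exists base.
(* With r letters and j vertices, [le] says r j <= |B| + j - 1 <= r + j - 1, so (r - 1)(j - 1) <=
   0. *)
have J1 : #|J| = 1%N.
  apply/eqP; rewrite eqn_leq J_gt0 andbT leqNgt; apply/negP => J2.
  have := leq_trans le (leq_add leB (leqnn _)).
  rewrite -(prednK J_gt0) mulnS leq_add2l /= leqNgt.
  by rewrite -[X in X < _]mul1n ltn_pmul2r ?gt1 // -ltnS prednK.
move=> g; have /sameP : same g 1.
  have /card_le1_eqP H : #|J| <= 1 by rewrite J1.
  by rewrite -st_eq; apply/eqP; apply: H.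
by rewrite invg1 mulg1.
Qed.

End Counting.

(** * An element in ping-pong position with several subgroups of infinite index *)

Definition powers (G : groupType) (f g : G) := exists n, g = f ^+ n \/ g = f ^- n.

Section Powers.
Variable G : groupType.
Implicit Types f g h : G.

Lemma powers_id f : powers f f.
Proof. by exists 1%N; left. Qed.

Lemma powers1 f : powers f 1.
Proof. by exists 0%N; left. Qed.

Lemma powersV f g : powers f g -> powers f g^-1.
Proof. by case=> n [] ->; exists n; [right | left; rewrite invgK]. Qed.

Lemma powersM f g h : powers f g -> powers f h -> powers f (g * h).
Proof.
have sub n m : n <= m -> powers f (f ^- n * f ^+ m).
  by move=> le; exists (m - n); left; rewrite -{1}(subnKC le) expgnDr mulKg.
have subV n m : n <= m -> powers f (f ^- m * f ^+ n).
  by move=> le; have /powersV := sub _ _ le; rewrite invgM invgK.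
have comm n m : f ^+ n * f ^- m = f ^- m * f ^+ n.
  by apply: (@commuteV _ (f ^+ n) (f ^+ m)); rewrite /commute -!expgnDr addnC.
case=> n + [m]; case=> -> [] ->.
- by exists (n + m); left; rewrite expgnDr.
- by rewrite comm; case/orP: (leq_total n m) => le; [exact: subV | exact: sub].
- by case/orP: (leq_total n m) => le; [exact: sub | exact: subV].
- by exists (m + n); right; rewrite expgnDr invgM.
Qed.

Lemma powers_trans f g h : powers f g -> powers g h -> powers f h.
Proof.
move=> fg [n gh]; have fX m : powers f (g ^+ m).
  by elim: m => [|m IH]; [exact: powers1 | rewrite expgS; exact: powersM].
by case: gh => ->; [exact: fX | exact/powersV/fX].
Qed.

Lemma powers_span f g : span [:: f] g <-> powers f g.
Proof.
split=> [|[n gE]].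
  elim=> {g} [|b g|b g]; first exact: powers1.
    by rewrite inE => /eqP-> _; apply: powersM; exact: powers_id.
  by rewrite inE => /eqP-> _; apply: powersM; exact/powersV/powers_id.
have S m : span [:: f] (f ^+ m).
  elim: m => [|m IH]; first exact: span1.
  by rewrite expgS; apply: span_consM => //; rewrite mem_head.
by case: gE => ->; [exact: S | exact/spanV/S].
Qed.

Lemma powers_commute f g h : powers f g -> powers f h -> commute g h.
Proof.
move=> [n gE] [m hE].
have C : commute (f ^+ n) (f ^+ m) by rewrite /commute -!expgnDr addnC.
case: gE hE => -> [] -> //; first exact: commuteV.
  exact/commute_sym/commuteV.
by apply: commuteV; exact/commute_sym/commuteV.
Qed.

Lemma powers_conj f g h : powers (f ^ h) (g ^ h) -> powers f g.
Proof.
by case=> n [] E; exists n; [left | right]; apply: (conjg_inj h);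
  rewrite ?conjVg conjXg.
Qed.

End Powers.

Section PingPong.
Variable G : groupType.
Implicit Types (f g h : G) (W H : G -> Prop).

Definition attracts W H := forall h g, H h -> h <> 1 -> ~ W g -> W (h * g).

(** The second clause supplies the start of the game: the innermost factor of an alternating word
    acts on an element of [H], which lies outside [W]. *)
Definition repels W H :=
  (forall h g, H h -> h <> 1 -> W g -> ~ W (h * g)) /\ (forall h, H h -> ~ W h).

End PingPong.

Section PingPongElement.
Variables (X : choiceType) (F : groupType) (x : X -> F).
Hypothesis x_basis : bijective (pres_lift x : presented (@no_relation X) -> F).
Local Notation ev := (word_eval x).
Local Notation red := (nform x_basis).
Local Notation covered := (covered x_basis).
Implicit Types (g h : F) (B : seq F) (u w : word X).

Definition positive w := all (fun a : X * bool => ~~ a.2) w.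

Lemma positive_reduced w : positive w -> reduced w.
Proof.
case: w => //= -[y []] //= w; rewrite /reduced /=.
elim: w y => //= -[z []] //= w IH y /IH ->.
by rewrite /linv xpair_eqE andbF.
Qed.

Lemma powers_letter c h : powers (x c) h -> h <> 1 ->
  exists n s, h = ev (nseq n.+1 (c, s)).
Proof.
have xX n : x c ^+ n = ev (nseq n (c, false)).
  elim: n => [|n IH]; first by rewrite word_eval0.
  by rewrite expgS IH [RHS]word_eval_cons word_eval1.
move=> [[|n] []] ->; rewrite ?invg1 // => _; exists n; first by exists false.
exists true; rewrite xX -word_evalV; congr word_eval.
by rewrite /word_inv map_nseq rev_nseq.
Qed.

Lemma nseq_cat_reduced n c s w : reduced w ->
  (if w is a :: _ then a.1 != c else true) -> reduced (nseq n (c, s) ++ w).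
Proof.
move=> rw wc; elim: n => [|n IH] //=; move: IH; rewrite /reduced /=.
case: n => [|n] /=; last by move->; rewrite /linv xpair_eqE eqxx; case: s.
by case: w rw wc => //= a w ->; rewrite /linv -pair_eqE /= /pair_eq /= => /negbTE->.
Qed.

Lemma covered_pigeonhole B (s : nat -> F) : (forall n, covered B (s n)) ->
  exists n m, n < m /\ span B (s n * (s m)^-1).
Proof.
move=> /(_ _)/cid2-/all_sig[k kP].
pose ks := map k (iota 0 (size (core_reps x_basis B)).+1).
have : ~~ uniq ks.
  apply/negP => /uniq_leq_size le; suff /le : {subset ks <= core_reps x_basis B}.
    by rewrite size_map size_iota ltnn.
  by move=> _ /mapP[n _ ->]; have [] := kP n.
move=> /(uniqPn 1)[n [m [nm]]]; rewrite size_map size_iota => lt.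
rewrite !(nth_map 0) ?size_iota ?(ltn_trans nm) // !nth_iota ?(ltn_trans nm) //.
rewrite !add0n => E; exists n, m; split=> //.
have [_ Sn] := kP n; have [_ Sm] := kP m.
by have := spanM Sn (spanV Sm); rewrite E !gnorm.
Qed.

(* If the cosets reached from (span B) u by positive words are finite in number, *)
(* each generator permutes them; they are then all the cosets.                  *)
Lemma positive_escape B u : (exists g, ~ covered B g) ->
  exists2 w, positive w & ~ covered B (ev (u ++ w)).
Proof.
move=> [g0 ng0]; apply: contrapT => no.
have C w : positive w -> covered B (ev (u ++ w)).
  by move=> pw; apply: contrapT => nc; apply: no; exists w.
have R v : exists2 w, positive w & span B (ev u * ev v * (ev (u ++ w))^-1).
  elim/last_ind: v => [|v [y b] [w pw Sw]].
    by exists [::] => //; rewrite cats0 word_eval0 mulg1 mulgV; exact: span1.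
  rewrite -cats1 word_eval_cat word_eval1 /=; case: b; last first.
    exists (rcons w (y, false)); first by rewrite /positive all_rcons.
    rewrite -cats1 catA (word_eval_cat _ (u ++ w)) word_eval1 /=.
    by move: Sw; rewrite !gnorm.
  (* An inverse letter: the powers of [y] must revisit a coset, at exponents n < m, so y^-1 can be
     replaced by y^(m-n-1). *)
  pose s n := ev (u ++ w) * x y ^+ n.
  have pos n : positive (w ++ nseq n (y, false)).
    by rewrite /positive all_cat -/(positive w) pw all_nseq orbT.
  have sE n : s n = ev (u ++ (w ++ nseq n (y, false))).
    rewrite catA [RHS]word_eval_cat; congr (_ * _).
    elim: n => [|n IH]; first by rewrite word_eval0.
    by rewrite expgS IH [RHS]word_eval_cons word_eval1.
  have Cs n : covered B (s n) by rewrite sE; exact: C.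
  have [n [m [nm Snm]]] := covered_pigeonhole Cs.
  exists (w ++ nseq (m - n).-1 (y, false)) => //.
  rewrite -sE /s.
  have -> : ev u * (ev v / x y) / (ev (u ++ w) * x y ^+ (m - n).-1) =
    (ev u * ev v * (ev (u ++ w))^-1) * (s n * (s m)^-1).
    have -> : s m = ev (u ++ w) * x y ^+ (m - n).-1 * x y * x y ^+ n.
      by rewrite /s -!mulgA -expgS -expgnDr addnS -addSn prednK ?subn_gt0 // subnK // ltnW.
    by rewrite /s !gnorm.
  exact: spanM.
apply: ng0; have [w pw] := R (red ((ev u)^-1 * g0)).
rewrite redK mulVKg => Sw.
by rewrite -[g0](mulgVK (ev (u ++ w))); apply: covered_mull Sw _; exact: C.
Qed.

(** The exit from a core is recorded by a prefix, so extending the word for further subgroups cannot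
    undo it. *)
Lemma killing_word (Bs : seq (seq F)) :
  (forall B, B \in Bs -> exists g, ~ covered B g) ->
  exists2 u, positive u &
    forall B, B \in Bs -> exists2 p, prefix p u & ~ covered B (ev p).
Proof.
elim: Bs => [|B Bs IH] H; first by exists [::].
have [|u pu uP] := IH; first by move=> C CB; apply: H; rewrite inE CB orbT.
have [w pw nw] := positive_escape u (H B (mem_head _ _)).
exists (u ++ w); first by rewrite /positive all_cat -/(positive u) pu.
move=> C; rewrite inE => /orP[/eqP->|/uP[p pp np]]; first by exists (u ++ w); rewrite ?prefix_refl.
by exists p => //; exact: prefix_catl.
Qed.

Lemma shortest_exit B u p : prefix p u -> ~ covered B (ev p) ->
  exists q, [/\ prefix q u, ~ covered B (ev q) &
    forall p', prefix p' q -> p' != q -> covered B (ev p')].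
Proof.
move=> pu np.
pose P n := `[< exists q, [/\ prefix q u, ~ covered B (ev q) & size q = n] >].
have exP : exists n, P n by exists (size p); apply/asboolP; exists p.
case: (ex_minnP exP) => n /asboolP[q [qu nq sq]] min; exists q; split=> // p' p'q ne.
apply: contrapT => np'; have : P (size p').
  by apply/asboolP; exists p'; split=> //; exact: prefix_trans qu.
move=> /min; rewrite -sq; case/prefixP: p'q ne => r ->.
rewrite size_cat; case: r => [|a r]; first by rewrite cats0 eqxx.
by rewrite addnS ltnNge leq_addr.
Qed.

Lemma ping_pong_element (Bs : seq (seq F)) (c d : X) : c != d ->
  (forall B, B \in Bs -> exists g, ~ covered B g) ->
  exists f W, [/\ f <> 1, ~ W 1, attracts W (powers f) &
    forall B, B \in Bs -> repels W (span B)].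
Proof.
move=> cd /killing_word[u0 pu0 u0P].
pose u := rcons u0 (d, false).
have pu : positive u by rewrite /positive all_rcons.
have ru := positive_reduced pu.
pose f := x c ^ (ev u)^-1; pose W g := prefix u (red g).
exists f, W; split.
- apply/eqP; rewrite conjg_eq1; apply/eqP => E.
  have := @red_ev _ _ _ x_basis [:: (c, false)] isT.
  by rewrite word_eval1 /= E red1.
- by rewrite /W red1 prefixs0 /u; case: u0 {u pu ru f W pu0 u0P}.
- move=> h g fh h1 nW.
  have [n [s Eh]] : exists n s, h ^ ev u = ev (nseq n.+1 (c, s)).
    apply: powers_letter; first by apply: (@powers_conj _ _ _ (ev u)^-1); rewrite conjgK.
    by apply/eqP; rewrite conjg_eq1; apply/eqP.
  (* Since [g] does not start with [u], the first letter of u^-1, the inverse of [d], survives; as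
     [c] differs from [d], powers of [c] cancel neither with it nor with the last letter of [u]. *)
  have [r Er] : exists r, red ((ev u)^-1 * g) = (d, true) :: r.
    have [a [b [e [Eu Eg ->]]]] := redM x_basis (ev u)^-1 g.
    have Eu' : (d, true) :: word_inv u0 = a ++ b.
      by rewrite -Eu redV red_ev // word_inv_rcons.
    case: a Eu' {Eu} => [/= Eb|a0 a [<- _]]; last by exists (a ++ e).
    case: nW; rewrite /W Eg -Eb; apply: prefix_catl.
    by rewrite word_inv_cons word_invK prefix_refl.
  have -> : h * g = ev (u ++ nseq n.+1 (c, s) ++ red ((ev u)^-1 * g)).
    by rewrite !word_eval_cat redK -Eh conjgE !gnorm.
  rewrite /W red_ev ?prefix_prefix // /u reduced_cat2 ru /linv /= xpair_eqE (negbTE cd) /=.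
  apply: (@nseq_cat_reduced n.+1); first exact: red_reduced.
  by rewrite Er /= eq_sym.
- move=> B /u0P[p pu0' np].
  (* [W] consists of reduced words that start with [q], the first exit from the core of [B], so
     [exit_disjoint] applies to it. *)
  have [q [qu nq qmin]] := shortest_exit (prefix_trans pu0' (prefix_rcons u0 (d, false))) np.
  split=> [h g Sh ne Wg Wh|h Sh Wh].
    by apply: ne; apply: (exit_disjoint nq qmin Sh (prefix_trans qu Wg) (prefix_trans qu Wh)).
  by apply: nq; apply: span_core Sh (prefix_trans qu Wh).
Qed.

End PingPongElement.

(** * The word metric of a free group *)

Section LongestCommonPrefix.
Variable T : eqType.
Implicit Types u v w : seq T.

Fixpoint lcp u v :=
  match u, v with
  | a :: u', b :: v' => if a == b then (lcp u' v').+1 else 0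
  | _, _ => 0
  end.

Lemma lcpC u v : lcp u v = lcp v u.
Proof. by elim: u v => [|a u IH] [|b v] //=; rewrite eq_sym IH. Qed.

Lemma lcp_leq u v : lcp u v <= size u.
Proof. by elim: u v => [|a u IH] [|b v] //=; case: ifP => // _; rewrite ltnS. Qed.

Lemma take_lcp u v n : n <= lcp u v -> take n u = take n v.
Proof.
elim: u v n => [|a u IH] [|b v] [|n] //=; case: eqP => // -> le.
by rewrite (IH v).
Qed.

Lemma lcp_geq u v n : n <= size u -> n <= size v -> take n u = take n v ->
  n <= lcp u v.
Proof.
elim: u v n => [|a u IH] [|b v] [|n] //= lu lv [-> E].
by rewrite eqxx ltnS; exact: IH.
Qed.

(** The tree inequality: the prefixes that [v] shares with [u] and with [w] are comparable. *)
Lemma lcp_ultra u v w : minn (lcp u v) (lcp v w) <= lcp u w.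
Proof.
apply: lcp_geq.
- exact: leq_trans (geq_minl _ _) (lcp_leq _ _).
- by apply: leq_trans (geq_minr _ _) _; rewrite lcpC lcp_leq.
- by rewrite (@take_lcp u v) ?geq_minl // (@take_lcp v w) // geq_minr.
Qed.

Lemma lcp_cat p u v : lcp (p ++ u) (p ++ v) = size p + lcp u v.
Proof. by elim: p => //= a p ->; rewrite eqxx. Qed.

End LongestCommonPrefix.

Section WordMetric.
Variables (X : choiceType) (F : groupType) (x : X -> F).
Hypothesis x_basis : bijective (pres_lift x : presented (@no_relation X) -> F).
Local Notation ev := (word_eval x).
Local Notation red := (nform x_basis).
Implicit Types (g h : F) (u w : word X).

Definition wlen g := size (red g).
(** The Gromov product at 1 in the Cayley tree of the basis; [len_divl] is its usual formula. *)
Definition gromov g h := lcp (red g) (red h).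

Lemma lenV g : wlen g^-1 = wlen g.
Proof. by rewrite /wlen redV size_word_inv. Qed.

Lemma len_ev w : wlen (ev w) <= size w.
Proof.
rewrite /wlen -(word_eval_reduce x w) red_ev ?reduce_reduced //.
elim: w => //= a w IH; case: (reduce w) IH => //= b v IH.
by case: ifP => _ /=; [exact: ltnW (ltnW _) | exact: IH].
Qed.

Lemma len_eq0 g : wlen g = 0 -> g = 1.
Proof. by move=> /size0nil; exact: red_eq0. Qed.

Lemma gprodC g h : gromov g h = gromov h g.
Proof. exact: lcpC. Qed.

Lemma gprod_ultra g h k : minn (gromov g h) (gromov h k) <= gromov g k.
Proof. exact: lcp_ultra. Qed.

Lemma len_divl g h : wlen (g^-1 * h) + (gromov g h).*2 = wlen g + wlen h.
Proof.
have [a [b [c [Eg Eh E]]]] := redM x_basis g^-1 h.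
rewrite /wlen /gromov E Eh; have -> : red g = word_inv b ++ word_inv a.
  by rewrite -word_inv_cat -Eg -redV invgK.
have rac : reduced (a ++ c) by rewrite -E red_reduced.
rewrite lcp_cat; have -> : lcp (word_inv a) c = 0.
  case/lastP: a rac {Eg E} => [|a l] //; rewrite word_inv_rcons.
  by case: c {Eh} => //= m c; rewrite reduced_cat2 eq_sym; case: eqP => //; rewrite andbF.
rewrite addn0 !size_cat !size_word_inv; lia.
Qed.

(** Otherwise the normal form agrees with its inverse up to the middle: a middle letter would be its
    own inverse, or the two middle letters would cancel. *)
Lemma gprod_inv g : g <> 1 -> (gromov g g^-1).*2 < wlen g.
Proof.
move=> g1; rewrite ltnNge; apply/negP => le.
have [n_gt0|] := posnP (wlen g); first by move/len_eq0: n_gt0.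
move=> n_gt0; set n := wlen g in le n_gt0.
have [a _] : exists a : X * bool, true.
  by move: n_gt0; rewrite /n /wlen; case: (red g) => // a *; exists a.
have E i : i.*2 < n -> nth a (red g) i = linv (nth a (red g) (n - i.+1)).
  move=> lt; have ltm : i < gromov g g^-1 by lia.
  rewrite -(nth_take a ltm) (take_lcp (leqnn _)) (nth_take a ltm) redV.
  rewrite /word_inv nth_rev ?size_map; last by rewrite -/(wlen g) -/n; lia.
  by rewrite (nth_map a) -?/(wlen g) -/n //; lia.
case: (boolP (odd n)) => odd_n.
  have := E n./2; have := odd_double_half n; rewrite odd_n => nE.
  have -> : n - (n./2).+1 = n./2 by lia.
  by move=> /(_ ltac:(lia))/esym/eqP; rewrite (negbTE (linv_neq _)).
have nE := odd_double_half n; rewrite (negbTE odd_n) in nE.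
have := E (n./2).-1; have -> : n - ((n./2).-1).+1 = (n./2).-1.+1 by lia.
move=> /(_ ltac:(lia)) Ei.
have /(sortedP a)/(_ (n./2).-1) := red_reduced x_basis g.
rewrite -/(wlen g) -/n => /(_ ltac:(lia)).
by rewrite Ei linvK eqxx.
Qed.

End WordMetric.

(** * Two elements of a free group generate a cyclic or a free group of rank two *)

(* lia identifies atoms syntactically, and the canonical instances hidden in    *)
(* x^-1 may differ; generalization identifies them up to conversion.            *)
Ltac metric_lia :=
  repeat match goal with
         | H : is_true _ |- _ => revert H
         | H : @eq nat _ _ |- _ => revert H
         end;
  repeat match goal with
         | |- context [@gromov ?X ?F ?x ?b ?g ?h] => move: (@gromov X F x b g h) => ?
         | |- context [@wlen ?X ?F ?x ?b ?g] => move: (@wlen X F x b g) => ?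
         end; lia.

Section FreePresented.
Variable X : choiceType.
Notation free := (presented (@no_relation X)).

Lemma pres_class_eval (R : word X -> word X -> Prop) w :
  pres_class R w = word_eval (pres_gen R) w.
Proof.
elim: w => [|[y b] w IH]; first by rewrite word_eval0.
rewrite word_eval_cons -IH word_eval1 /= -[RHS]/(pres_mul _ _).
have -> : (if b then (pres_gen R y)^-1 else pres_gen R y) = pres_class R [:: (y, b)].
  case: b => //; apply: (@mulgI _ (pres_gen R y)).
  rewrite mulgV -[RHS]/(pres_mul _ _) pres_mulE.
  by apply/pres_classP/WordSym; exact: (WordCancel _ _ false).
by rewrite pres_mulE.
Qed.

Variables (G : groupType).

Lemma free_liftM (f : X -> G) : {morph (pres_lift f : free -> G) : p q / p * q}.
Proof. exact: pres_liftM. Qed.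

Lemma free_lift_gen (f : X -> G) y : pres_lift f (pres_gen (@no_relation X) y) = f y.
Proof. exact: pres_lift_gen. Qed.

Lemma free_lift_unique (h : free -> G) : {morph h : p q / p * q} ->
  h =1 pres_lift (h \o pres_gen (@no_relation X)).
Proof.
by move=> hM q; rewrite -{1}(pres_classK q) pres_class_eval (morph_word_eval hM).
Qed.

End FreePresented.

Lemma pres_gen_basis (X : choiceType) :
  bijective (pres_lift (pres_gen (@no_relation X)) : presented (@no_relation X) -> _).
Proof.
exists id => q; last by rewrite -(@free_lift_unique _ _ id).
by rewrite -(@free_lift_unique _ _ id).
Qed.

Section Pairs.
Variable G : groupType.
Implicit Types x y g : G.

Notation free2_group := (presented (@no_relation bool)).
Notation gen := (pres_gen (@no_relation bool)).

Definition pairf (H : groupType) (x y : H) (b : bool) := if b then y else x.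

Definition free2 x y :=
  forall q : free2_group, pres_lift (pairf x y) q = 1 -> q = 1.

Definition dichotomic x y := free2 x y \/ exists w, powers w x /\ powers w y.

(** This covers Nielsen moves: the endomorphism sending the generators to [a], [b] has a left
    inverse, sending them to [a'], [b']. It is thus injective, and a relation between [x] and [y]
    comes from one between [x'] and [y']. *)
Lemma free2_subst (a b a' b' : free2_group) x y x' y' :
  pres_lift (pairf x' y') a = x -> pres_lift (pairf x' y') b = y ->
  pres_lift (pairf a' b') a = gen false -> pres_lift (pairf a' b') b = gen true ->
  free2 x' y' -> free2 x y.
Proof.
move=> Ex Ey Ea Eb fr q Eq.
have M (H : groupType) (f : bool -> H) :
    {morph (pres_lift f \o pres_lift (pairf a b) : free2_group -> H) : p q / p * q}.
  by move=> u v /=; rewrite !free_liftM.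
have : pres_lift (pairf x' y') (pres_lift (pairf a b) q) = 1.
  rewrite -[LHS]/((_ \o _) q) (free_lift_unique (M _ _)) -Eq; congr pres_lift.
  by apply/funext => -[]; rewrite /= free_lift_gen.
move/fr => E; have : pres_lift (pairf a' b') (pres_lift (pairf a b) q) = 1.
  by rewrite E (morph1 (free_liftM _)).
rewrite -[LHS]/((_ \o _) q) (free_lift_unique (M _ _)).
have -> : (pres_lift (pairf a' b') \o pres_lift (pairf a b)) \o gen = gen.
  by apply/funext => -[]; rewrite /= free_lift_gen.
by rewrite -(@free_lift_unique _ _ id).
Qed.

Lemma dichotomic_swap x y : dichotomic y x -> dichotomic x y.
Proof.
case=> [fr|[w [wy wx]]]; last by right; exists w.
by left; apply: (@free2_subst (gen true) (gen false) (gen true) (gen false)) fr;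
  rewrite !free_lift_gen.
Qed.

Lemma dichotomic_invl x y : dichotomic x^-1 y -> dichotomic x y.
Proof.
case=> [fr|[w [wx wy]]]; last by right; exists w; rewrite -(invgK x); split=> //; exact: powersV.
by left; apply: (@free2_subst (gen false)^-1 (gen true) (gen false)^-1 (gen true)) fr;
  rewrite ?(morphV (free_liftM _)) !free_lift_gen /= ?invgK.
Qed.

Lemma dichotomic_invr x y : dichotomic x y^-1 -> dichotomic x y.
Proof. by move=> /dichotomic_swap/dichotomic_invl/dichotomic_swap. Qed.

Lemma dichotomic_mulr x y : dichotomic x (x * y) -> dichotomic x y.
Proof.
case=> [fr|[w [wx wxy]]]; last first.
  by right; exists w; split=> //; rewrite -(mulKg x y); apply: powersM => //; exact: powersV.
left; apply: (@free2_subst (gen false) ((gen false)^-1 * gen true)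
                           (gen false) (gen false * gen true)) fr;
  rewrite ?free_liftM ?(morphV (free_liftM _)) !free_lift_gen /= ?mulKg //.
Qed.

Lemma dichotomic_mulVr x y : dichotomic x (x^-1 * y) -> dichotomic x y.
Proof.
move=> D; apply/dichotomic_invl/dichotomic_mulr/dichotomic_invl.
by rewrite invgK.
Qed.

Lemma dichotomic_conj g x y : dichotomic (x ^ g) (y ^ g) -> dichotomic x y.
Proof.
case=> [fr|[w [wx wy]]]; last first.
  by right; exists (w ^ g^-1); split; apply: (@powers_conj _ _ _ g); rewrite conjgKV.
left=> q Eq; apply: fr.
have M : {morph (fun q : free2_group => pres_lift (pairf x y) q ^ g) : p q / p * q}.
  by move=> u v; rewrite free_liftM conjMg.
have := free_lift_unique M q; rewrite Eq conj1g => ->; congr pres_lift.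
by apply/funext => -[]; rewrite /= free_lift_gen.
Qed.

End Pairs.

Section Dichotomy.
Variables (X : choiceType) (F : groupType) (x0 : X -> F).
Hypothesis x_basis : bijective (pres_lift x0 : presented (@no_relation X) -> F).
Local Notation ev := (word_eval x0).
Local Notation red := (nform x_basis).
Local Notation len := (wlen x_basis).
Local Notation gprod := (gromov x_basis).
Implicit Types (x y g : F).

Section PairPingPong.
Variables x y : F.
Let E (s : bool * bool) : F := word_eval (pairf x y) [:: s].
(** Nielsen's condition: in a reduced word, the cancellations of [E s] with its two neighbours do
    not use it up. *)
Hypothesis short : forall s s' s'', s' != s -> s'' != linv s ->
  gprod (E s) (E s') + gprod (E (linv s)) (E s'') < len (E s).

Let EV s : E (linv s) = (E s)^-1.
Proof. by rewrite /E !word_eval1; case: s => z [] /=; rewrite ?invgK. Qed.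

(** The elements that share with [E s] a longer prefix than any other letter does; the tree
    inequality makes these sets disjoint. *)
Let W s g := forall s', s' != s -> gprod (E s) (E s') < gprod (E s) g.

Let W_disjoint s t g : W s g -> W t g -> s = t.
Proof.
move=> Ws Wt; apply/eqP/negPn/negP => ne.
have := Ws t; have := Wt s ne; rewrite eq_sym => + /(_ ne).
have := gprod_ultra x_basis (E s) g (E t).
rewrite (gprodC _ g) (gprodC _ (E t) (E s)); metric_lia.
Qed.

Let W_step s g : ~ W (linv s) g -> W s (E s * g).
Proof.
move=> nW s' ne.
have [s'' ne'' le] : exists2 s'', s'' != linv s &
    gprod (E (linv s)) g <= gprod (E (linv s)) (E s'').
  apply: contrapT => no; apply: nW => s'' ne''; rewrite ltnNge; apply/negP => le.
  by apply: no; exists s''.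
have := short ne ne''; have := len_divl x_basis (E s) (E s * g).
have := len_divl x_basis (E s)^-1 g; rewrite invgK mulKg lenV -EV.
metric_lia.
Qed.

(** A nonempty reduced word takes its value in the set [W] of its first letter, which cannot contain
    1. *)
Lemma short_pair_free2 : free2 x y.
Proof.
move=> q Eq; apply: (red_eq0 (x_basis := @pres_gen_basis bool)).
case Ew : (nform _ q) => [//|a w].
suff /(_ (linv a)) : W a (word_eval (pairf x y) (a :: w)).
  rewrite -Ew; have -> : word_eval (pairf x y) (nform (@pres_gen_basis bool) q) = 1.
    rewrite -[RHS]Eq -[in RHS](redK (@pres_gen_basis bool) q).
    rewrite (morph_word_eval (free_liftM (pairf x y))); congr word_eval.
    by apply/funext => b; rewrite /= free_lift_gen.
  move=> /(_ (linv_neq a)); rewrite (gprodC _ _ 1) {2}/gromov red1.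
  by case: (nform _ _).
have := red_reduced (@pres_gen_basis bool) q; rewrite Ew; move: a {Ew}.
elim: w => [|b w IH] a rw; rewrite word_eval_cons; apply: W_step => Wa.
  have := Wa a; rewrite eq_sym linv_neq => /(_ isT).
  by rewrite word_eval0 (gprodC _ _ 1) {2}/gromov red1; case: (nform _ _).
have [] : b <> linv a /\ reduced (b :: w).
  by move: rw; rewrite /reduced /= => /andP[/eqP].
by move=> ne /IH /W_disjoint/(_ Wa).
Qed.

End PairPingPong.

(** Either one of the cancellations exceeds half of [x], and a Nielsen move shortens the pair, or
    both are exactly half. In the latter case [p] and [q] are [y] and [y^-1] in some order, because
    [x] and [x^-1] share less than half of their letters, and [L3] applies. *)
Lemma dichotomic_reduce x y p q : x <> 1 ->
  (forall x1 y1, len x1 + len y1 < len x + len y -> dichotomic x1 y1) ->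
  [\/ p = x^-1, p = y | p = y^-1] -> [\/ q = x, q = y | q = y^-1] ->
  len x <= gprod x p + gprod x^-1 q -> dichotomic x y.
Proof.
move=> x1 IH pE qE le.
have inv := gprod_inv x_basis x1.
have x_gt0 : 0 < len x by metric_lia.
have L1 (z : F) : gprod x z + gprod x z > len x -> (z = y \/ z = y^-1) -> dichotomic x y.
  move=> lt zE; suff : dichotomic x z.
    by case: zE => ->; [exact | exact: dichotomic_invr].
  apply/dichotomic_mulVr/IH; have := len_divl x_basis x z.
  have : len z = len y by case: zE => ->; rewrite ?lenV.
  metric_lia.
have L2 (z : F) : gprod x^-1 z + gprod x^-1 z > len x -> (z = y \/ z = y^-1) -> dichotomic x y.
  move=> lt zE; suff : dichotomic x z.
    by case: zE => ->; [exact | exact: dichotomic_invr].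
  apply/dichotomic_mulr/IH; have := len_divl x_basis x^-1 z; rewrite invgK lenV.
  have : len z = len y by case: zE => ->; rewrite ?lenV.
  metric_lia.
(* Here x = A B and z = A M B with |A| = |B| = |x| / 2, and conjugating by A   *)
(* turns x and z x^-1 into B A and M.                                          *)
have L3 z : gprod x z + gprod x z = len x ->
    gprod x^-1 z^-1 + gprod x^-1 z^-1 = len x -> (z = y \/ z = y^-1) -> dichotomic x y.
  move=> Ez EzV zE; suff : dichotomic x z.
    by case: zE => ->; [exact | exact: dichotomic_invr].
  have lz : len z = len y by case: zE => ->; rewrite ?lenV.
  have lD := len_divl x_basis x z.
  (* [x^-1 * z] is as long as [z], so a [z] shorter than [x] gives a shorter pair; otherwise the
     prefix [A] and the suffix [B] of [z] do not overlap. *)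
  case: (ltnP (len z) (len x)) => [lt|ge].
    apply/dichotomic_swap/dichotomic_mulVr/dichotomic_invr/dichotomic_swap.
    by rewrite invgM invgK; apply: IH; metric_lia.
  set k := gprod x z in Ez.
  have Ek : gprod x^-1 z^-1 = k by metric_lia.
  pose A := take k (red x); pose B := drop k (red x).
  have ExAB : red x = A ++ B by rewrite cat_take_drop.
  have szx : size (red x) = k + k by rewrite -[LHS]/(len x) Ez.
  have szA : size A = k by rewrite size_take szx; case: ltnP => //; metric_lia.
  have szB : size B = k by rewrite size_drop szx; metric_lia.
  have EA : take k (red z) = A by rewrite -(take_lcp (leqnn k)).
  have EB : take k (red z^-1) = word_inv B.
    rewrite -(@take_lcp _ (red x^-1)) ?[lcp _ _]Ek // redV ExAB word_inv_cat.
    by rewrite take_cat size_word_inv szB ltnn subnn take0 cats0.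
  pose C := word_inv (drop k (red z^-1)).
  have EzC : red z = C ++ B.
    by rewrite -[z]invgK redV -(cat_take_drop k (red z^-1)) EB word_inv_cat word_invK.
  have szC : size C + k = len z by rewrite /wlen EzC size_cat szB.
  have [M EC] : exists M, C = A ++ M.
    exists (drop k C); rewrite -EA EzC takel_cat ?cat_take_drop //; metric_lia.
  have Ex : x = ev A * ev B by rewrite -word_eval_cat -ExAB redK.
  have Ezz : z = ev A * ev M * ev B by rewrite -!word_eval_cat -EC -EzC redK.
  apply/dichotomic_invr/dichotomic_mulr/dichotomic_invr.
  apply: (@dichotomic_conj _ (ev A)); apply: IH.
  have -> : x ^ ev A = ev (B ++ A) by rewrite conjgE Ex word_eval_cat !gnorm.
  have -> : (x * z^-1)^-1 ^ ev A = ev M.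
    by rewrite conjgE Ex Ezz !gnorm.
  have := len_ev x_basis (B ++ A); have := len_ev x_basis M.
  have : size M + k = size C by rewrite EC size_cat szA addnC.
  rewrite size_cat szA szB -lz; metric_lia.
case: pE qE le => -> [] ->.
- by rewrite (gprodC _ x^-1 x); metric_lia.
- by move=> le; apply: (L2 y); [metric_lia | left].
- by move=> le; apply: (L2 y^-1); [metric_lia | right].
- by rewrite (gprodC _ x^-1 x) => le; apply: (L1 y); [metric_lia | left].
- move=> le; case: (ltnP (len x) (gprod x y + gprod x y)) => [lt|le1];
    first by apply: (L1 y); [|left].
  case: (ltnP (len x) (gprod x^-1 y + gprod x^-1 y)) => [lt|le2];
    first by apply: (L2 y); [|left].
  have := gprod_ultra x_basis x y x^-1; rewrite (gprodC _ y x^-1); metric_lia.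
- move=> le; case: (ltnP (len x) (gprod x y + gprod x y)) => [lt|le1];
    first by apply: (L1 y); [|left].
  case: (ltnP (len x) (gprod x^-1 y^-1 + gprod x^-1 y^-1)) => [lt|le2];
    first by apply: (L2 y^-1); [|right].
  by apply: (L3 y); [metric_lia | metric_lia | left].
- by rewrite (gprodC _ x^-1 x) => le; apply: (L1 y^-1); [metric_lia | right].
- move=> le; case: (ltnP (len x) (gprod x y^-1 + gprod x y^-1)) => [lt|le1];
    first by apply: (L1 y^-1); [|right].
  case: (ltnP (len x) (gprod x^-1 y + gprod x^-1 y)) => [lt|le2];
    first by apply: (L2 y); [|left].
  by apply: (L3 y^-1); rewrite ?invgK; [metric_lia | metric_lia | right].
- move=> le; case: (ltnP (len x) (gprod x y^-1 + gprod x y^-1)) => [lt|le1];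
    first by apply: (L1 y^-1); [|right].
  case: (ltnP (len x) (gprod x^-1 y^-1 + gprod x^-1 y^-1)) => [lt|le2];
    first by apply: (L2 y^-1); [|right].
  have := gprod_ultra x_basis x y^-1 x^-1; rewrite (gprodC _ y^-1 x^-1); metric_lia.
Qed.

(** Nielsen reduction by induction on the total length: a pair to which [short_pair_free2] does not
    apply violates its condition at some letter, which is the first entry after swapping and
    inverting. *)
Lemma free_dichotomy x y : dichotomic x y.
Proof.
have [n] := ubnP (len x + len y); elim: n x y => // n IHn x y le.
have IH x1 y1 : len x1 + len y1 < len x + len y -> dichotomic x1 y1.
  by move=> lt; apply: IHn; exact: leq_trans lt _.
have [-> | x1] := eqVneq x 1; first by right; exists y; split; [exact: powers1 | exact: powers_id].
have [-> | y1] := eqVneq y 1; first by right; exists x; split; [exact: powers_id | exact: powers1].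
apply: contrapT => nD; apply: (nD); left; apply: short_pair_free2 => s s' s'' ne' ne''.
rewrite ltnNge; apply/negP => le'; apply: nD.
case: s s' s'' ne' ne'' le' => z b [z' b'] [z'' b''] ne' ne''.
rewrite !word_eval1 /=; set u := pairf x y z; set v := pairf x y (~~ z).
have D : dichotomic u v -> dichotomic x y.
  by rewrite /u /v; case: z {ne' ne'' u v} => //=; exact: dichotomic_swap.
have u1 : u <> 1 by apply/eqP; rewrite /u; case: z {ne' ne'' u v D}.
have IHu x2 y2 : len x2 + len y2 < len u + len v -> dichotomic x2 y2.
  have E : len u + len v = len x + len y.
    by rewrite /u /v; case: (z) => //=; rewrite addnC.
  by rewrite E; exact: IH.
move=> le'; apply: D.
suff : dichotomic (if b then u^-1 else u) v by case: (b) => // /dichotomic_invl.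
have Eb : (if ~~ b then u^-1 else u) = (if b then u^-1 else u)^-1.
  by case: (b); rewrite /= ?invgK.
rewrite Eb in le'; apply: dichotomic_reduce le'.
- by case: (b) => //; apply/eqP; rewrite invg_eq1; apply/eqP.
- by move=> x2 y2 lt; apply: IHu; case: (b) lt => //; rewrite lenV.
- rewrite /u /v; clear -ne'; case: z z' b b' ne' => [] [] [] [] //= _;
  rewrite ?invgK; by [constructor 1 | constructor 2 | constructor 3].
- rewrite /u /v; clear -ne''; case: z z'' b b'' ne'' => [] [] [] [] //= _;
  rewrite ?invgK; by [constructor 1 | constructor 2 | constructor 3].
Qed.

End Dichotomy.

(** * Free products and conjugate products *)

Section FreeOver.
Variable G : groupType.
Implicit Types (C A W : G -> Prop) (L : seq (G * G)).

Definition conj_prod L := foldr (fun p g => p.1 * p.2 * p.1^-1 * g) 1 L.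

Definition alternating C A L :=
  (forall p, p \in L -> [/\ A p.1, C p.2 & p.2 <> 1]) /\
  sorted (fun p q : G * G => p.1 != q.1) L.

(* For subgroups C and A, this says that <C, A> is naturally C * A: moving the  *)
(* letters from A to the right, an alternating word is conj_prod L * a with L   *)
(* alternating and a in A.                                                      *)
Definition free_over C A :=
  forall L, L <> [::] -> alternating C A L -> ~ A (conj_prod L).

Lemma alternating_cons C A p L :
  alternating C A (p :: L) -> [/\ A p.1, C p.2, p.2 <> 1 & alternating C A L].
Proof.
move=> [H sL]; have [Ap Cp p1] := H p (mem_head _ _); split=> //; split.
  by move=> q qL; apply: H; rewrite inE qL orbT.
exact: path_sorted sL.
Qed.

Lemma free_over_sub C A C' A' :
  (forall g, C' g -> C g) -> (forall g, A' g -> A g) ->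
  free_over C A -> free_over C' A'.
Proof.
move=> CC AA fr L L0 [H sL] /AA; apply: fr L0 _; split=> // p /H[/AA ? /CC ? ?].
by split.
Qed.

Lemma conj_prod_shift (g : G) L :
  conj_prod [seq (g * p.1, p.2) | p <- L] = g * conj_prod L * g^-1.
Proof.
elim: L => [|p L IH] /=; first by rewrite mulg1 mulgV.
by rewrite IH !gnorm.
Qed.

(** A product with first conjugator [b] is [b] times an element of [W]: neighbouring conjugators
    differ, so [b^-1 * b'] is a nontrivial element of [A] and takes [W] off itself. A value in [A]
    would give an element of [A] in [W]. *)
Lemma ping_pong C A W :
  (forall g h, A g -> A h -> A (g * h)) -> (forall g, A g -> A g^-1) ->
  attracts W C -> repels W A -> free_over C A.
Proof.
move=> AM AV aW [rW nW] [//|[b e] L] _ aL AL.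
have : exists2 g, W g & conj_prod ((b, e) :: L) = b * g.
  move: aL {AL}; elim: L b e => [|[b' e'] L IH] b e aL0;
    have [/= Ab Ce e1 aL] := alternating_cons aL0.
    exists (e * b^-1); last by rewrite mulg1 mulgA.
    by apply: aW => //; apply/nW/AV.
  have [g Wg Eg] := IH _ _ aL; exists (e * (b^-1 * (b' * g))); last first.
    by rewrite -Eg /= !mulgA.
  have [Ab' _ _ _] := alternating_cons aL.
  apply: aW => //; rewrite mulgA; apply: rW => //; first by apply: AM => //; exact: AV.
  case: aL0 => _ /= /andP[/eqP ne _] E; apply: ne.
  by rewrite -(mulVKg b b') E mulg1.
case=> g Wg Eg; have [Ab _ _ _] := alternating_cons aL.
by apply: (nW g) => //; rewrite -(mulKg b g) -Eg; apply: AM => //; exact: AV.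
Qed.

End FreeOver.

Lemma free_over_image (G H : groupType) (h : G -> H) (C A : G -> Prop) :
  {morph h : x y / x * y} -> injective h -> free_over C A ->
  free_over (fun y => exists2 x, C x & y = h x) (fun y => exists2 x, A x & y = h x).
Proof.
move=> hM h_inj fr L L0 [LP sL].
have [L' EL] : exists L', L = [seq (h p.1, h p.2) | p <- L'] /\
    forall p, p \in L' -> [/\ A p.1, C p.2 & p.2 <> 1].
  elim: L LP {L0 sL} => [|[b e] L IH] LP; first by exists [::].
  have [|L' [-> L'P]] := IH; first by move=> p pL; apply: LP; rewrite inE pL orbT.
  have [/= [b' Ab ->] [e' Ce ->] e1] := LP _ (mem_head _ _).
  exists ((b', e') :: L'); split=> // p; rewrite inE => /orP[/eqP->|/L'P//].
  by split=> //= E; apply: e1; rewrite E (morph1 hM).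
case: EL => EL L'P [a Aa Ea].
have EP : h (conj_prod L') = conj_prod L.
  rewrite EL; elim: (L') => [|p M IH] /=; first exact: morph1.
  by rewrite !hM (morphV hM) IH.
apply: (fr L'); first by move=> E; apply: L0; rewrite EL E.
  split=> //; move: sL; rewrite EL sorted_map; apply: sub_sorted => p q /=.
  by apply: contraNneq => ->.
by move: Aa; congr A; apply: h_inj; rewrite EP Ea.
Qed.

(** Ping-pong in the abstract free group, [W] being the reduced words whose first letter is the
    first generator or its inverse; the injective evaluation map carries the result to [G]. *)
Lemma free2_free_over (G : groupType) (x y : G) :
  free2 x y -> free_over (powers x) (powers y).
Proof.
move=> fr; pose h := pres_lift (pairf x y) : presented (@no_relation bool) -> G.
have hM : {morph h : p q / p * q} := free_liftM (pairf x y).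
have h_inj : injective h := morph_inj hM fr.
pose gen := pres_gen (@no_relation bool).
have B := @pres_gen_basis bool.
pose W g := if nform B g is a :: _ then a.1 == false else false.
have frg : free_over (powers (gen false)) (powers (gen true)).
  apply: (@ping_pong _ _ _ W).
  - exact: powersM.
  - exact: powersV.
  - move=> g k /powers_letter gl g1 Wk; have [n [s ->]] := gl g1.
    rewrite -(redK B k) -word_eval_cat /W red_ev //.
    apply: nseq_cat_reduced; first exact: red_reduced.
    by move: Wk; rewrite /W; case: (nform B k) => // a w /negP.
  - split=> [g k /powers_letter gl g1|g /powers_letter gl].
      have [n [s ->]] := gl g1; rewrite {1}/W => Wk.
      rewrite -(redK B k) -word_eval_cat /W red_ev //.
      apply: nseq_cat_reduced; first exact: red_reduced.
      by case: (nform B k) Wk => // a w /eqP->.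
    have [->|g1] := eqVneq g 1; first by rewrite /W red1.
    have [n [s ->]] := gl (elimN eqP g1); rewrite /W red_ev //.
    by rewrite -[nseq _ _]cats0; exact: nseq_cat_reduced.
have im z g : powers (h z) g -> exists2 k, powers z k & g = h k.
  by case=> n [] ->; [exists (z ^+ n) | exists (z ^- n)];
    rewrite ?(morphV hM) ?(morphX hM) //; exists n; [left | right].
apply: free_over_sub (free_over_image hM h_inj frg) => g.
  by rewrite -[x]/(pairf x y false) -(free_lift_gen (pairf x y)) => /im.
by rewrite -[y]/(pairf x y true) -(free_lift_gen (pairf x y)) => /im.
Qed.

(** * Torsion, roots and centralizers in free groups *)

Section FreeGroupCommutation.
Variables (X : choiceType) (F : groupType) (x0 : X -> F).
Hypothesis x_basis : bijective (pres_lift x0 : presented (@no_relation X) -> F).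
Local Notation len := (wlen x_basis).
Local Notation gprod := (gromov x_basis).
Implicit Types (x y z g : F).

(** By [gprod_inv], less than half of [x] cancels in [x * x]. The cancellation of [x] against
    [x ^+ n] is then the same for all n > 0, and a nonempty prefix of [x] survives. *)
Lemma free_torsion_free x n : 0 < n -> x ^+ n = 1 -> x = 1.
Proof.
case: n => // n _ xn; apply: contrapT => x1.
have inv := gprod_inv x_basis x1.
suff [_ lt] : gprod x^-1 (x ^+ n.+1) = gprod x^-1 x /\
    gprod x^-1 x < gprod x (x ^+ n.+1).
  by move: lt; rewrite xn /gromov red1; case: (nform x_basis x).
elim: n {xn} => [|n [E1 _]].
  split; rewrite expg1 //; have := len_divl x_basis x x.
  rewrite mulVg /wlen red1 -/(len x) (gprodC _ x^-1 x) /=; metric_lia.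
have E2 : gprod x (x ^+ n.+2) + gprod x^-1 x = len x.
  have := len_divl x_basis x (x ^+ n.+2); have := len_divl x_basis x^-1 (x ^+ n.+1).
  rewrite invgK [x ^+ n.+2]expgS mulKg E1 lenV; metric_lia.
have lt : gprod x^-1 x < gprod x (x ^+ n.+2).
  by move: inv E2; rewrite (gprodC _ x^-1 x); metric_lia.
split=> //; have := gprod_ultra x_basis x^-1 x (x ^+ n.+2).
have := gprod_ultra x_basis x^-1 (x ^+ n.+2) x.
rewrite (gprodC _ (x ^+ n.+2) x); metric_lia.
Qed.

Lemma free_root_unique x y n : 0 < n -> commute x y -> x ^+ n = y ^+ n -> x = y.
Proof.
move=> n0 xy E; apply: divg1_eq; apply: (free_torsion_free n0).
by rewrite expgnFl // E mulgV.
Qed.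

Lemma commute_not_free2 x y z : powers y z -> z <> 1 -> commute x z -> ~ free2 x y.
Proof.
move=> yz z1 xz fr; have x1 : x <> 1.
  move=> Ex; have := fr (pres_gen _ false); rewrite free_lift_gen => /(_ Ex) E.
  have := @red_ev _ _ _ (@pres_gen_basis bool) [:: (false, false)] isT.
  by rewrite word_eval1 /= E red1.
(* The product is [x * (z * x^-1 * z^-1) = 1], alternating with value in [powers y]. *)
apply: (free2_free_over fr (L := [:: (1, x); (z, x^-1)])) => //.
  split=> [p|]; last by rewrite /= andbT eq_sym; apply/eqP.
  rewrite !inE => /orP[] /eqP-> /=.
    by split=> //; [exact: powers1 | exact: powers_id].
  split=> //; first exact/powersV/powers_id.
  by move/eqP; rewrite invg_eq1 => /eqP.
rewrite /= mul1g invg1 !mulg1 mulgA mulgA xz mulgK mulgV; exact: powers1.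
Qed.

(** Centralizers are locally cyclic: a new element and the generator found so far cannot be a free
    pair, since [z] is a nontrivial power of that generator; so both are powers of one element. *)
Lemma commuting_seq_cyclic z (s : seq F) : z <> 1 ->
  (forall g, g \in s -> commute g z) ->
  exists w, powers w z /\ forall g, g \in s -> powers w g.
Proof.
move=> z1; elim: s => [|g s IH] C; first by exists z; split=> //; exact: powers_id.
have [|w [wz ws]] := IH; first by move=> k ks; apply: C; rewrite inE ks orbT.
have [fr|[v [vg vw]]] := free_dichotomy x_basis g w.
  by case: (commute_not_free2 wz z1 (C _ (mem_head _ _)) fr).
exists v; split=> [|k]; first exact: powers_trans wz.
by rewrite inE => /orP[/eqP->//|/ws]; exact: powers_trans.
Qed.

(* Finitely many elements of A lie, together with z, in a cyclic subgroup <w>,   *)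
(* and f and w form a free pair since f does not commute with z.                *)
Lemma free_over_centralizer (G : groupType) (f z : G) (A : G -> Prop) :
  (forall a, A a -> commute a z) -> ~ commute f z ->
  (forall s : seq G, (forall a, a \in s -> A a) -> exists h : F -> G,
     [/\ {morph h : x y / x * y}, injective h &
         forall a, a \in f :: z :: s -> exists b, a = h b]) ->
  free_over (powers f) A.
Proof.
move=> Az fz loc L L0 [LP sL] AL.
(* The product itself is included, since it too must be a power of the common generator. *)
pose s := conj_prod L :: [seq p.1 | p <- L].
have As a : a \in s -> A a.
  by rewrite inE => /orP[/eqP->//|/mapP[p /LP[Ap _ _] ->]].
have [h [hM h_inj hs]] := loc s As.
have [f' Ef] := hs f (mem_head _ _).
have [z' Ez] : exists b, z = h b by apply: hs; rewrite !inE eqxx orbT.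
have fz' : ~ commute f' z'.
  by move=> E; apply: fz; rewrite /commute Ef Ez -!hM E.
have z1 : z' <> 1 by move=> E; apply: fz'; rewrite E; exact: commute1.
have [s' Es'] : exists s', s = [seq h b | b <- s'].
  have : forall a, a \in s -> exists b, a = h b.
    by move=> a sa; apply: hs; rewrite 2!in_cons sa !orbT.
  elim: (s) => [|a t IH] H; first by exists [::].
  have [|t' ->] := IH; first by move=> b bt; apply: H; rewrite inE bt orbT.
  by have [b ->] := H a (mem_head _ _); exists (b :: t').
have [|w [wz ws]] := commuting_seq_cyclic (s := s') z1.
  move=> b sb; apply: h_inj; rewrite !hM -Ez; apply: Az; apply: As.
  by rewrite Es' map_f.
have [fr|[v [vf vw]]] := free_dichotomy x_basis f' w; last first.
  by apply: fz'; apply: powers_commute vf (powers_trans vw wz).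
have ws' a : a \in s -> exists2 b, powers w b & a = h b.
  by rewrite Es' => /mapP[b /ws wb ->]; exists b.
apply: (free_over_image hM h_inj (free2_free_over fr) L0); last first.
  by apply: ws'; rewrite mem_head.
split=> // p pL; have [_ [n fp] p1] := LP p pL; split=> //.
  by apply: ws'; rewrite inE map_f ?orbT.
by case: fp => ->; [exists (f' ^+ n) | exists (f' ^- n)];
  rewrite ?(morphV hM) ?(morphX hM) ?Ef //; exists n; [left | right].
Qed.

End FreeGroupCommutation.

(** * Normal forms in free products *)

Section Naturality.
Variable G : groupType.

Definition span_pred (B : seq G) : {pred G} := fun g => `[< span B g >].

Lemma span_predM B : mulg_closed (span_pred B).
Proof. by move=> g h /asboolP Sg /asboolP Sh; apply/asboolP; exact: spanM. Qed.
Lemma span_predV B : invg_closed (span_pred B).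
Proof. by move=> g /asboolP Sg; apply/asboolP; exact: spanV. Qed.
Lemma span_pred1 B : 1 \in span_pred B.
Proof. by apply/asboolP; exact: span1. Qed.

HB.instance Definition _ B := isMulClosed.Build G (span_pred B) (@span_predM B).
HB.instance Definition _ B := isMul1Closed.Build G (span_pred B) (span_pred1 B).
HB.instance Definition _ B := isInvClosed.Build G (span_pred B) (@span_predV B).

Lemma generated_span (S : {pred G}) (B : seq G) g :
  (forall b, b \in S -> span B b) -> g \in generated S -> span B g.
Proof.
move=> SB /generatedP/(_ (GroupClosed.clone G (span_pred B) _)) H.
by apply/asboolP; apply: H => b /SB Sb; apply/asboolP.
Qed.

Variables (H K : groupType).
Local Notation inl := (@free_prod_inl H K).
Local Notation inr := (@free_prod_inr H K).

Lemma free_prod_inlM : {morph inl : a b / a * b}.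
Proof.
move=> a b; rewrite [RHS]pres_mulE; apply/pres_classP/WordSym/WordRel.
exact: FreeProdL.
Qed.

Lemma free_prod_inrM : {morph inr : a b / a * b}.
Proof.
move=> a b; rewrite [RHS]pres_mulE; apply/pres_classP/WordSym/WordRel.
exact: FreeProdR.
Qed.

(** Such elements are stable under left multiplication by letters: one from [K] shifts all
    conjugators, one from [H] adds a factor with conjugator 1, merged with the first factor if that
    has conjugator 1 too. *)
Lemma free_prod_normal_form (q : free_prod H K) : exists (L : seq (K * H)) (a : K),
  [/\ forall p, p \in L -> p.2 <> 1, sorted (fun p r : K * H => p.1 != r.1) L &
      q = conj_prod [seq (inr p.1, inl p.2) | p <- L] * inr a].
Proof.
pose nf (q : free_prod H K) := exists (L : seq (K * H)) (a : K),
  [/\ forall p, p \in L -> p.2 <> 1, sorted (fun p r : K * H => p.1 != r.1) L &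
      q = conj_prod [seq (inr p.1, inl p.2) | p <- L] * inr a].
have nfr b u : nf u -> nf (inr b * u).
  case=> L [a [L1 sL ->]]; exists [seq (b * p.1, p.2) | p <- L], (b * a); split.
  - by move=> _ /mapP[p /L1 ? ->].
  - by rewrite sorted_map; apply: sub_sorted sL => p r /=; rewrite (inj_eq (mulgI b)).
  - rewrite free_prod_inrM !mulgA; congr (_ * _).
    elim: L {L1 sL} => [|p L IH] /=; first by rewrite mul1g mulg1.
    by rewrite -[RHS]mulgA -IH free_prod_inrM !gnorm.
have nfl e u : nf u -> nf (inl e * u).
  case=> L [a [L1 sL ->]]; have [->|e1] := eqVneq e 1.
    by rewrite (morph1 free_prod_inlM) mul1g; exists L, a.
  have r1 := morph1 free_prod_inrM.
  case: L L1 sL => [|[b e'] L] L1 sL.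
    exists [:: (1, e)], a; split=> //; first by move=> p; rewrite inE => /eqP->; apply/eqP.
    by rewrite /= r1 !gnorm.
  have [Eb|b1] := eqVneq b 1; last first.
    exists ((1, e) :: (b, e') :: L), a; split.
    - by move=> p; rewrite inE => /orP[/eqP->|/L1//]; apply/eqP.
    - by rewrite /= eq_sym b1.
    - by rewrite /= r1 !gnorm.
  have [Ee|ee] := eqVneq (e * e') 1.
    exists L, a; split; first by move=> p pL; apply: L1; rewrite inE pL orbT.
      exact: path_sorted sL.
    by rewrite /= Eb r1 !gnorm -free_prod_inlM Ee (morph1 free_prod_inlM) mul1g.
  exists ((1, e * e') :: L), a; split.
  - by move=> p; rewrite inE => /orP[/eqP->|pL]; [apply/eqP | apply: L1; rewrite inE pL orbT].
  - by move: sL; rewrite Eb; case: (L).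
  - by rewrite /= Eb r1 free_prod_inlM !gnorm.
rewrite -(pres_classK q) pres_class_eval; elim: (repr q) => [|c w IH].
  by exists [::], 1; split=> //; rewrite word_eval0 (morph1 free_prod_inrM) mulg1.
rewrite word_eval_cons word_eval1; case: c => -[e|b] [] /=.
- by rewrite -[pres_gen _ _]/(inl e) -(morphV free_prod_inlM); exact: nfl.
- exact: nfl.
- by rewrite -[pres_gen _ _]/(inr b) -(morphV free_prod_inrM); exact: nfr.
- exact: nfr.
Qed.

End Naturality.

(** The natural map turns a normal form into [conj_prod M * val a]; if this is 1, then [conj_prod M]
    lies in [A], which forces [M] to be empty. *)
Lemma free_over_natural (G : groupType) (f : G) (A : groupClosed G) :
  free_over (powers f) (fun g => g \in A) ->
  naturally_free_product (cyclic_subgroup f) A.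
Proof.
move=> fr; have NM : {morph @natural_map G (cyclic_subgroup f) A : p q / p * q}.
  exact: free_prod_liftM.
apply: (morph_inj NM) => q Nq.
have [L [a [L1 sL Eq]]] := free_prod_normal_form q.
have Nl e : @natural_map G (cyclic_subgroup f) A (free_prod_inl _ e) = val e.
  exact: free_prod_lift_inl.
have Nr b : @natural_map G (cyclic_subgroup f) A (free_prod_inr _ b) = val b.
  exact: free_prod_lift_inr.
pose M := [seq (val p.1, val p.2) | p <- L].
have EM : conj_prod M * val a = 1.
  rewrite -Nq Eq NM Nr; congr (_ * _); rewrite /M; elim: (L) => [|p L' IH] /=.
    by rewrite (morph1 NM).
  by rewrite !NM (morphV NM) Nl Nr IH.
have M0 : M = [::].
  apply: contrapT => M0; apply: (fr M M0).
    split; last by rewrite sorted_map; apply: sub_sorted sL => p r /=.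
    move=> _ /mapP[p pL ->] /=; split.
    - exact: (valP p.1).
    - apply/powers_span; have := valP p.2; apply: generated_span => b.
      by rewrite inE => /eqP->; apply: span_mem; rewrite mem_head.
    - by move=> E; apply: (L1 p pL); apply: val_inj.
  have -> : conj_prod M = (val a)^-1 by rewrite -[LHS]mulg1 -(mulgV (val a)) mulgA EM mul1g.
  by apply: gpredVr; exact: (valP a).
move: EM Eq; rewrite M0 mul1g => Ea ->.
have -> : L = [::] by move: M0; rewrite /M; case: (L).
have -> : a = 1 by apply: val_inj.
by rewrite (morph1 (@free_prod_inrM _ _)) mulg1.
Qed.

(** * Ascending HNN-extensions *)

Section BijectionGroup.
Variable T : Type.

(** The inverse is part of the data. This group receives the representation that shows [F] to embed
    in the HNN-extension. *)
Definition bijection : Type :=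
  {p : (T -> T) * (T -> T) | cancel p.1 p.2 /\ cancel p.2 p.1}.
HB.instance Definition _ := gen_eqMixin bijection.
HB.instance Definition _ := gen_choiceMixin bijection.

Implicit Types p q r : bijection.

Lemma bijection_eq p q : (sval p).1 = (sval q).1 -> (sval p).2 = (sval q).2 -> p = q.
Proof.
case: p q => [[f g] fg] [[f' g'] fg'] /= Ef Eg.
by apply: eq_exist; rewrite /= Ef Eg.
Qed.

Definition bij_one : bijection :=
  exist _ (id, id) (conj (fun x : T => erefl x) (fun x : T => erefl x)).

Definition bij_inv p : bijection :=
  exist _ ((sval p).2, (sval p).1) (conj (svalP p).2 (svalP p).1).

Definition bij_mul p q : bijection :=
  exist _ ((sval p).1 \o (sval q).1, (sval q).2 \o (sval p).2)
    (conj (can_comp (svalP p).1 (svalP q).1) (can_comp (svalP q).2 (svalP p).2)).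

Lemma bij_mulA : associative bij_mul.
Proof. by move=> p q r; exact: bijection_eq. Qed.

Lemma bij_mul1 : left_id bij_one bij_mul.
Proof. by move=> p; exact: bijection_eq. Qed.

Lemma bij_mulr1 : right_id bij_one bij_mul.
Proof. by move=> p; exact: bijection_eq. Qed.

Lemma bij_mulV : left_inverse bij_one bij_inv bij_mul.
Proof. by move=> p; apply: bijection_eq; apply/funext => x /=; exact: (svalP p).1. Qed.

Lemma bij_mulrV : right_inverse bij_one bij_inv bij_mul.
Proof. by move=> p; apply: bijection_eq; apply/funext => x /=; exact: (svalP p).2. Qed.

HB.instance Definition _ := isGroup.Build bijection
  bij_mulA bij_mul1 bij_mulr1 bij_mulV bij_mulrV.

End BijectionGroup.

Section HNNExtension.
Variables (F : groupType) (phi : {multiplicative F -> F}).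
Hypothesis phi_inj : injective phi.
Let phiM : {morph phi : x y / x * y}.
Proof. exact: gmulfM. Qed.
Local Notation base := (hnn_base phi).
Local Notation t := (hnn_stable phi).
Local Notation psi := (@hnn_psi F phi).
Implicit Types (u v : F) (g h : hnn phi).

Lemma iter_phiM n : {morph iter n phi : u v / u * v}.
Proof. by elim: n => // n IH u v /=; rewrite IH phiM. Qed.

Section Injectivity.

(* Unions of classes of pairs (n, u) under (n, u) ~ (n + 1, phi u), the pair     *)
(* (n, u) standing for t^-n u t^n.                                               *)
Let space := {Q : nat -> F -> Prop | forall n u, Q n u = Q n.+1 (phi u)}.

Let space_eq (Q R : space) : (forall n u, sval Q n u = sval R n u) -> Q = R.
Proof.
case: Q R => [Q HQ] [R HR] /= E; apply: eq_exist.
by apply/funext => n; apply/funext => u; exact: E.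
Qed.

(** [F] acts by left translation and t by conjugation on the union of the t^-n F t^n, here on its
    subsets; moving [v] past t^-n turns it into phi^n(v). *)
Let act_base v (Q : space) : space.
Proof.
exists (fun n u => sval Q n (iter n phi v^-1 * u)) => n u.
by rewrite (svalP Q) phiM.
Defined.

Let act_baseK v : cancel (act_base v) (act_base v^-1).
Proof.
move=> Q; apply: space_eq => n u /=.
by rewrite mulgA -iter_phiM invgK mulVg (morph1 (iter_phiM n)) mul1g.
Qed.

Let act_stable (Q : space) : space.
Proof. by exists (fun n u => sval Q n.+1 u) => n u; exact: (svalP Q). Defined.

Let act_stableV (Q : space) : space.
Proof. by exists (fun n u => sval Q n (phi u)) => n u; exact: (svalP Q). Defined.

Let rep_base v : bijection space.
Proof.
exists (act_base v, act_base v^-1); split; first exact: act_baseK.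
by move=> Q /=; have := act_baseK v^-1 Q; rewrite invgK.
Defined.

Let rep_stable : bijection space.
Proof.
by exists (act_stable, act_stableV); split=> Q; apply: space_eq => n u /=;
  rewrite -(svalP Q).
Defined.

Let rep (y : F + unit) := if y is inl v then rep_base v else rep_stable.

Let rep_rel p q : hnn_rel phi p q -> word_eval rep p = word_eval rep q.
Proof.
case=> [a b|a]; rewrite /word_eval !big_cons !big_nil /= ?mulg1;
  apply: bijection_eq; apply/funext => Q; apply: space_eq => n u /=.
- by rewrite mulgA -iter_phiM -invgM.
- by rewrite mulgA -iter_phiM -!invgM.
- by rewrite -(svalP Q) -[phi (iter n phi _)]iterS iterSr (morphV phiM).
- by rewrite -(svalP Q) -[phi (iter n phi _)]iterS iterSr !(morphV phiM).
Qed.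

Lemma hnn_base_inj : injective base.
Proof.
apply: (morph_inj (@hnn_baseM _ phi)) => v E.
have : pres_lift rep (base v) = 1 by rewrite E (morph1 (pres_liftM rep_rel)).
rewrite (pres_lift_gen rep_rel) => /(congr1 (fun p => (sval p).1)) /= Eact.
(* The subset {1} is moved by every v other than 1; injectivity of [phi] makes it a union of
   classes. *)
have Q1 (n : nat) u : (u = 1) = (phi u = 1).
  apply/propext; split=> [->|]; first exact: (morph1 phiM).
  by rewrite -{1}(morph1 phiM) => /phi_inj.
pose Q : space := exist _ (fun=> fun u => u = 1) Q1.
have := congr1 (fun f => sval (f Q) 0 1) Eact; rewrite /= mulg1 => /esym Ev.
have : v^-1 = 1 by rewrite -Ev.
by move/eqP; rewrite invg_eq1 => /eqP.
Qed.

End Injectivity.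

Lemma hnn_conjX n u : t ^+ n * base u * t ^- n = base (iter n phi u).
Proof.
elim: n => [|n IH]; first by rewrite expg0 invg1 mulg1 mul1g.
by rewrite iterS -hnn_conj -IH expgS invgM !mulgA.
Qed.

Lemma hnn_psi1 : psi 1 = 0%R.
Proof. by have := hnn_psi_base phi 1; rewrite (morph1 (@hnn_baseM _ phi)). Qed.

Lemma hnn_psiV g : psi g^-1 = (- psi g)%R.
Proof. by have := hnn_psiM g g^-1; rewrite mulgV hnn_psi1; lia. Qed.

Lemma hnn_psiX n : psi (t ^+ n) = n%:Z%R.
Proof.
elim: n => [|n IH]; first exact: hnn_psi1.
by rewrite expgS hnn_psiM hnn_psi_stable IH; lia.
Qed.

Lemma hnn_psiJ g h : psi (h * g * h^-1) = psi g.
Proof. by rewrite !hnn_psiM hnn_psiV; lia. Qed.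

Lemma hnn_normal_form g : exists a u b, g = t ^- a * base u * t ^+ b.
Proof.
rewrite -(pres_classK g) pres_class_eval.
elim: (repr g) => [|[c e] w [a [u [b E]]]].
  exists 0%N, 1, 0%N; rewrite word_eval0 (morph1 (@hnn_baseM _ phi)).
  by rewrite expg0 invg1 !mulg1.
have mul_base v : exists a' u' b', base v * (t ^- a * base u * t ^+ b) =
    t ^- a' * base u' * t ^+ b'.
  exists a, (iter a phi v * u), b.
  rewrite hnn_baseM !mulgA; congr (_ * _ * _).
  by rewrite -hnn_conjX !gnorm.
rewrite word_eval_cons E word_eval1 /=; case: c => [v|[]].
  have -> : (if e then (pres_gen (hnn_rel phi) (inl v))^-1 else pres_gen (hnn_rel phi) (inl v))
       = base (if e then v^-1 else v).
    by case: e => //; rewrite (morphV (@hnn_baseM _ phi)).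
  exact: mul_base.
case: e.
  exists a.+1, u, b; rewrite -[pres_gen _ _]/t !mulgA; congr (_ * _ * _).
  by rewrite expgSr invgM.
rewrite -[pres_gen _ _]/t; case: a {E mul_base} => [|a].
  exists 0%N, (phi u), b.+1; rewrite expg0 invg1 !mul1g.
  by rewrite -hnn_conj expgS !gnorm.
exists a, u, b; rewrite !mulgA; congr (_ * _ * _).
by rewrite expgSr invgM mulgA mulgV mul1g.
Qed.

(** [N] is the exponent of t^-1 in a normal form. That every larger n works allows a common n for
    several elements. *)
Lemma hnn_eventually g k : psi g = k%:Z%R ->
  exists N, forall n, N <= n -> exists u, t ^+ n * g * t ^- n = base u * t ^+ k.
Proof.
have [a [u [b ->]]] := hnn_normal_form g.
rewrite !hnn_psiM hnn_psiV !hnn_psiX hnn_psi_base => E.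
have Eb : b = (a + k)%N by lia.
exists a => n le; exists (iter (n - a) phi u).
have C : t ^+ b * t ^- n = t ^- (n - a) * t ^+ k.
  apply: (mulgI (t ^+ (n - a))); apply: (mulIg (t ^+ n)).
  by rewrite !mulgA mulgVK mulgV mul1g -!expgnDr; congr (_ ^+ _); lia.
rewrite -hnn_conjX -[RHS]mulgA -C !mulgA; congr (_ * _ * _ * _).
by rewrite -{1}(subnK le) expgnDr mulgK.
Qed.

End HNNExtension.

(** * Subgroups with hyperbolic elements *)

Lemma exists_min (T : eqType) (m : T -> int) (s : seq T) : s <> [::] ->
  exists2 a, a \in s & forall b, b \in s -> (m a <= m b)%R.
Proof.
elim: s => // a s IH _; case: s IH => [|b s] IH.
  by exists a; rewrite ?mem_head // => b; rewrite inE => /eqP->.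
have [//|c cs cmin] := IH; have [le|lt] := boolP (m a <= m c)%R.
  exists a; rewrite ?mem_head // => d; rewrite in_cons => /orP[/eqP->//|/cmin].
  exact: Order.POrderTheory.le_trans.
exists c; first by rewrite inE cs orbT.
by move=> d; rewrite in_cons => /orP[/eqP->|/cmin//]; lia.
Qed.

Section Ascending.
Variables (F : groupType) (phi : {multiplicative F -> F}).
Hypothesis phi_inj : injective phi.
Local Notation base := (hnn_base phi).
Local Notation t := (hnn_stable phi).
Local Notation psi := (@hnn_psi F phi).
Local Notation baseM := (@hnn_baseM F phi).
Implicit Types (u v : F) (g h : hnn phi).

(** * Ping-pong for a subgroup with hyperbolic elements *)

Section PingPong.
Variables (f : F) (W H : F -> Prop) (A : hnn phi -> Prop).
Hypotheses (AM : forall g h, A g -> A h -> A (g * h))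
           (AV : forall g, A g -> A g^-1).
Hypotheses (HM : forall u v, H u -> H v -> H (u * v))
           (HV : forall u, H u -> H u^-1).
Hypotheses (aW : attracts W (powers f)) (rW : repels W H).
Hypothesis A_elliptic : forall a, A a -> psi a = 0%R -> exists2 v, H v & a = base v.
Hypothesis A_positive : forall a v, A a -> (0 < psi a)%R ->
  exists2 v', H v' & a * base v * a^-1 = base v'.

Hypothesis H1 : H 1.

(* The first entry p of M with psi p.1 = 0 puts conj_prod M in the translate s W. *)
Let entry (M : seq (hnn phi * hnn phi)) v :=
  exists M0 p M1 (s w : F), [/\ M = M0 ++ p :: M1, psi p.1 = 0%R,
    H s & base s = conj_prod M0 * p.1] /\ (v = s * w /\ W w).

Let base_powers e : powers (base f) e -> e <> 1 ->
  exists e', [/\ powers f e', e' <> 1 & e = base e'].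
Proof.
case=> n eE e1; have [e' [fe' Ee]] : exists e', powers f e' /\ e = base e'.
  by case: eE => ->; [exists (f ^+ n) | exists (f ^- n)];
    rewrite ?(morphV baseM) ?(morphX baseM) //; split=> //; exists n; [left | right].
by exists e'; split=> // E; apply: e1; rewrite Ee E (morph1 baseM).
Qed.

(** Factors with [psi p.1 > 0] lie in [H]; those with [psi p.1 = 0] play ping-pong on [W]. The
    product of the positive factors between two of the latter could only spoil the game by bringing
    the two translates of [W] together; it would then lie in [A] and be a shorter counterexample,
    excluded by the first hypothesis. *)
Let entry_or_positive n M :
  (forall L, size L < n -> L <> [::] -> alternating (powers (base f)) A L ->
     ~ A (conj_prod L)) ->
  size M <= n -> alternating (powers (base f)) A M ->
  (forall p, p \in M -> (0 <= psi p.1)%R) ->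
  exists2 v, conj_prod M = base v &
    ((forall p, p \in M -> (0 < psi p.1)%R) /\ H v) \/ entry M v.
Proof.
move=> IHn; elim: M => [|[b e] M IH] szM aM pos.
  by exists 1; [rewrite (morph1 baseM) | left].
have [/= Ab fe e1 aM'] := alternating_cons aM.
have [|p pM|v Ev vP] := IH _ aM'; first exact: ltnW.
  by apply: pos; rewrite inE pM orbT.
have [e' [fe' e'1 Ee]] := base_powers fe e1.
have /= b_ge0 := pos _ (mem_head _ _).
have [b_gt0|b_le0] := boolP (0 < psi b)%R.
  have [v1 Hv1 Ev1] := A_positive e' Ab b_gt0.
  exists (v1 * v); first by rewrite baseM -Ev -Ev1 Ee.
  case: vP => [[Mp Hv]|[M0 [p [M1 [s [w [[EM p0 Hs Es] [-> Ww]]]]]]]].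
    left; split; last exact: HM.
    by move=> p; rewrite inE => /orP[/eqP->|/Mp].
  right; exists ((b, e) :: M0), p, M1, (v1 * s), w; rewrite mulgA; split=> //.
  split=> //; [by rewrite EM | exact: HM | by rewrite baseM Es -Ev1 Ee /= !mulgA].
have b0 : psi b = 0%R by lia.
have [c Hc Eb] := A_elliptic Ab b0.
exists (c * (e' * (c^-1 * v))).
  by rewrite /= Ev Ee Eb !baseM (morphV baseM) !mulgA.
right; exists [::], (b, e), M, c, (e' * (c^-1 * v)); split; first by rewrite /= mul1g.
split=> //; apply: aW => //; case: vP => [[_ Hv]|].
  by apply: rW.2; apply: HM => //; exact: HV.
move=> [M0 [p [M1 [s [w [[EM p0 Hs Es] [-> Ww]]]]]]].
rewrite mulgA; apply: rW.1 => //; first by apply: HM => //; exact: HV.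
move=> Ecs; have Esc : c = s by rewrite -(mulVKg c s) Ecs mulg1.
case: M0 EM Es => [|p0' M0] EM Es.
  case: aM => _; rewrite EM /= => /andP[/eqP ne _]; apply: ne.
  by rewrite Eb Esc Es /= mul1g.
apply: (IHn (p0' :: M0)) => //.
- by apply: leq_trans szM; rewrite EM /= size_cat /=; lia.
- case: aM' => Mp; rewrite EM => /cat_sorted2[sM _]; split=> // q qM.
  by apply: Mp; rewrite EM mem_cat qM.
- have -> : conj_prod (p0' :: M0) = b * p.1^-1 by rewrite Eb Esc Es mulgK.
  apply: AM => //; apply: AV; case: aM' => Mp _.
  by have [] := Mp p; rewrite ?EM ?mem_cat ?mem_head ?orbT.
Qed.

(** Translating by the inverse of a conjugator with least psi makes this value 0 and preserves
    membership in [A]. The product, elliptic in [A], lies in [H] and also in a translate s W with s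
    in [H], although [H] and [W] are disjoint. *)
Lemma free_over_hyperbolic : free_over (powers (base f)) A.
Proof.
move=> L; have [n] := ubnP (size L); elim: n L => // n IHn L szL L0 aL AL.
have [p0 pL pmin] := exists_min (fun p => psi p.1) L0.
have [LP sL] := aL; have [Ap0 _ _] := LP _ pL.
pose M := [seq (p0.1^-1 * p.1, p.2) | p <- L].
have aM : alternating (powers (base f)) A M.
  split; last by rewrite sorted_map; apply: sub_sorted sL => p q /=; rewrite (inj_eq (mulgI _)).
  by move=> _ /mapP[p /LP[Ap fp p1] ->]; split=> //=; apply: AM => //; exact: AV.
have Mpos p : p \in M -> (0 <= psi p.1)%R.
  by move=> /mapP[q qL ->] /=; rewrite hnn_psiM hnn_psiV; have /= := pmin q qL; lia.
have M0 : (p0.1^-1 * p0.1, p0.2) \in M by apply/mapP; exists p0.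
have AM' : A (conj_prod M).
  rewrite conj_prod_shift invgK; apply: AM => //; apply: AM => //; exact: AV.
have szM : size M <= n by rewrite size_map.
have [v Ev [[Mp _]|]] := entry_or_positive IHn szM aM Mpos.
  by have := Mp _ M0; rewrite /= mulVg hnn_psi1.
move=> [M1 [p [M2 [s [w [[EM pp Hs Es] [Evs Ww]]]]]]].
have [|v' Hv' Ev'] := A_elliptic AM'; first by rewrite Ev hnn_psi_base.
have Evv : v = v' by apply: (hnn_base_inj phi_inj); rewrite -Ev.
apply: (rW.2 w) => //; rewrite -(mulKg s w) -Evs Evv; apply: HM => //; exact: HV.
Qed.

End PingPong.

(** Conjugation by [h] fixes [c] and maps t^-(N+1) F t^(N+1) into t^-N F t^N; repeating this ends in
    [F]. *)
Lemma hnn_elliptic_base u k c h :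
  h = base u * t ^+ k.+1 -> psi c = 0%R -> commute h c -> exists v, c = base v.
Proof.
move=> Eh c0 hc; have [N HN] := hnn_eventually (k := 0) c0.
have [v Ev] := HN N (leqnn N); rewrite mulg1 in Ev.
have {HN Ev c0} : c = t ^- N * base v * t ^+ N by rewrite -Ev !gnorm.
elim: N v => [|N IH] v Ec; first by exists v; rewrite Ec expg0 invg1 mulg1 mul1g.
apply: (IH (iter N phi u * iter k phi v * (iter N phi u)^-1)).
have -> : c = h * c * h^-1 by rewrite hc mulgK.
rewrite Eh {1}Ec !baseM (morphV baseM) -!hnn_conjX.
have C : t ^+ k.+1 * t ^- N.+1 = t ^- N * t ^+ k.
  apply: (mulgI (t ^+ N)); apply: (mulIg (t ^+ N.+1)).
  by rewrite !mulgA mulgVK mulgV mul1g -!expgnDr; congr (_ ^+ _); lia.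
have CV : t ^+ N.+1 * t ^- k.+1 = t ^- k * t ^+ N.
  by have := congr1 (fun g => g^-1) C; rewrite !invgM !invgK.
rewrite !invgM !invgK !mulgA -(mulgA (base u)) C -(mulgA _ (t ^+ N.+1)) CV.
by rewrite !gnorm.
Qed.

(** Descent on psi: [a = b * h0], where conjugation by [h0] already maps [F] into [H] and [b] has
    smaller psi, until [b] is elliptic and comes from [H]. *)
Lemma positive_conj (A : hnn phi -> Prop) (H : F -> Prop) h0 :
  (forall g h, A g -> A h -> A (g * h)) -> (forall g, A g -> A g^-1) ->
  A h0 -> (0 < psi h0)%R ->
  (forall b, A b -> (0 < psi b)%R -> (psi h0 <= psi b)%R) ->
  (forall u v, H u -> H v -> H (u * v)) -> (forall u, H u -> H u^-1) ->
  (forall v, exists2 v', H v' & h0 * base v * h0^-1 = base v') ->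
  (forall a, A a -> psi a = 0%R -> exists2 v, H v & a = base v) ->
  forall a v, A a -> (0 < psi a)%R -> exists2 v', H v' & a * base v * a^-1 = base v'.
Proof.
move=> AM AV Ah0 h0p hmin HM HV Hh0 HA a.
have [n] := ubnP `|psi a|%N; elim: n a => // n IH a le v Aa ap.
pose b := a * h0^-1; have Ab : A b by apply: AM => //; exact: AV.
have Eb : psi b = (psi a - psi h0)%R by rewrite hnn_psiM hnn_psiV.
have [v1 Hv1 Ev1] := Hh0 v; have le0 := hmin a Aa ap.
have -> : a * base v * a^-1 = b * base v1 * b^-1.
  by rewrite -Ev1 /b !gnorm.
have [b0|bp] := eqVneq (psi b) 0%R.
  have [w Hw ->] := HA b Ab b0; exists (w * v1 * w^-1).
    by apply: (HM); [exact: HM | exact: HV].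
  by rewrite !baseM (morphV baseM).
by apply: IH => //; lia.
Qed.

End Ascending.

(** * The choice of the elliptic element *)

Section FreeGroupRank.
Variables (X : choiceType) (F : groupType) (x : X -> F).
Hypothesis x_basis : bijective (pres_lift x : presented (@no_relation X) -> F).
Local Notation ev := (word_eval x).

(** The letters occurring in the finitely many generators are all the letters: the exponent sum of
    any other letter [y] is a homomorphism to the integers that kills the generators but not
    [x y]. *)
Lemma finitely_generated_basis : finitely_generated F ->
  exists xs : seq X, uniq xs /\ forall y, y \in xs.
Proof.
case=> B FB; pose xs := undup (flatten [seq [seq a.1 | a <- nform x_basis b] | b <- B]).
exists xs; split=> [|y]; first exact: undup_uniq.
apply: contrapT => /negP nxs.
pose d (z : X) : infinite_cyclic := if z == y then 1%R else 0%R.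
pose chi g := word_eval d (nform x_basis g).
have chiE w : chi (ev w) = word_eval d w.
  by apply: word_eval_cong0; apply: (ev_cong x_basis); rewrite redK.
have chiM : {morph chi : g h / g * h}.
  move=> g h; rewrite -(redK x_basis g) -(redK x_basis h) -word_eval_cat !chiE.
  exact: word_eval_cat.
have chiB b : b \in B -> chi b = 1.
  move=> Bb; have : forall a, a \in nform x_basis b -> a.1 != y.
    move=> a ab; apply: contraNneq nxs => <-; rewrite mem_undup.
    by apply/flatten_mapP; exists b => //; exact: map_f.
  rewrite /chi; elim: (nform x_basis b) => [|a w IH] H; first by rewrite word_eval0.
  rewrite word_eval_cons IH => [|c cw]; last by apply: H; rewrite inE cw orbT.
  rewrite word_eval1 /d (negbTE (H _ (mem_head _ _))) mulg1.
  by case: a.2.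
have chi1 g : chi g = 1.
  have : span B g by apply: (@generated_span F (mem B)) => // b; exact: span_mem.
  elim=> {g} [|b g Bb _ IH|b g Bb _ IH]; first exact: (morph1 chiM).
    by rewrite chiM chiB // IH mulg1.
  by rewrite chiM (morphV chiM) chiB // IH invg1 mulg1.
have := chi1 (x y); have -> : x y = ev [:: (y, false)] by rewrite word_eval1.
by rewrite chiE word_eval1 /d eqxx.
Qed.

Lemma nonabelian_basis : ~ (forall g h : F, commute g h) -> exists c d : X, c != d.
Proof.
move=> nab; apply: contrapT => no; apply: nab => g h.
have same (c d : X) : c = d.
  by apply/eqP/negPn/negP => ne; apply: no; exists c, d.
have comm_letter k : (forall y, commute k (x y)) -> forall l, commute k l.
  move=> kx l; rewrite -(redK x_basis l); elim: (nform x_basis l) => [|a w IH].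
    by rewrite word_eval0; exact: commute1.
  rewrite word_eval_cons; apply: commuteM => //; rewrite word_eval1.
  by case: a.2; [apply: commuteV | ]; exact: kx.
apply: (comm_letter) => y; apply/commute_sym; apply: comm_letter => z.
by rewrite (same z y).
Qed.

(** If the core were everything, its finitely many representatives would meet all cosets, and the
    index bound would make [B] generate [F]. *)
Lemma not_covered (xs : seq X) (B : seq F) :
  uniq xs -> (forall y, y \in xs) -> 1 < size xs -> size B <= size xs ->
  (exists g, ~ span B g) -> exists g, ~ covered x_basis B g.
Proof.
move=> ux ax gt1 leB [g ng]; apply: contrapT => no; apply: ng.
apply: (@schreier_bound _ _ _ x_basis xs B (core_reps x_basis B)) => // k.
by apply: contrapT => nk; apply: no; exists k.
Qed.

End FreeGroupRank.

(** * The subgroups A_i at a common level *)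

Section Main.
Variables (X : choiceType) (F : groupType) (x : X -> F).
Hypothesis x_basis : bijective (pres_lift x : presented (@no_relation X) -> F).
Variable phi : {multiplicative F -> F}.
Hypothesis phi_inj : injective phi.
Local Notation base := (hnn_base phi).
Local Notation t := (hnn_stable phi).
Local Notation psi := (@hnn_psi F phi).
Local Notation baseM := (@hnn_baseM F phi).
Implicit Types (u v : F) (g h a : hnn phi) (A : groupClosed (hnn phi)).

Let level n v := t ^- n * base v * t ^+ n.

Let levelM n : {morph level n : u v / u * v}.
Proof. by move=> u v; rewrite /level baseM !gnorm. Qed.

Let level_inj n : injective (level n).
Proof. by move=> u v /mulIg/mulgI/(hnn_base_inj phi_inj). Qed.

Let level_elliptic g : psi g = 0%R ->
  exists N, forall n, N <= n -> exists v, g = level n v.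
Proof.
move=> /(hnn_eventually (k := 0))[N HN]; exists N => n /HN[v Ev]; exists v.
by move: Ev; rewrite mulg1 /level => <-; rewrite !gnorm.
Qed.

Let level_seq (s : seq (hnn phi)) : (forall g, g \in s -> psi g = 0%R) ->
  exists n, forall g, g \in s -> exists v, g = level n v.
Proof.
move=> s0; suff [N HN] : exists N, forall n, N <= n -> forall g, g \in s ->
    exists v, g = level n v by exists N; exact: HN.
elim: s s0 => [|g s IH] s0; first by exists 0%N.
have [|N1 H1] := IH; first by move=> k ks; apply: s0; rewrite inE ks orbT.
have [N2 H2] := level_elliptic (s0 _ (mem_head _ _)).
exists (maxn N1 N2) => n; rewrite geq_max => /andP[le1 le2] k.
by rewrite inE => /orP[/eqP->|]; [exact: H2 | exact: H1].
Qed.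

Let shifted A n : hnn phi -> Prop := fun g => t ^- n * g * t ^+ n \in A.

Let shiftedM A n g h : shifted A n g -> shifted A n h -> shifted A n (g * h).
Proof. by move=> Ag Ah; have := gpredM _ _ Ag Ah; rewrite /shifted !gnorm. Qed.

Let shiftedV A n g : shifted A n g -> shifted A n g^-1.
Proof. by move=> /(gpredVr _); rewrite /shifted !invgM !invgK !mulgA. Qed.

Let shiftedK A n g : g \in A -> shifted A n (t ^+ n * g * t ^- n).
Proof. by rewrite /shifted !gnorm. Qed.

Let psi_shift n g : psi (t ^- n * g * t ^+ n) = psi g.
Proof. by rewrite !hnn_psiM hnn_psiV; lia. Qed.

Let psi_unshift n g : psi (t ^+ n * g * t ^- n) = psi g.
Proof. exact: hnn_psiJ. Qed.

(** Separates what a single [A] requires from the choice of [f]: one [f] in ping-pong position with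
    all the sets [B] serves all the subgroups. *)
Definition pinned A n (B : seq F) := forall f W, f <> 1 -> ~ W 1 ->
  attracts W (powers f) -> repels W (span B) ->
  free_over (powers (base f)) (shifted A n).

Lemma elliptic_pinned A z : ~ (forall u v : F, commute u v) -> z \in A -> z <> 1 ->
  (forall a, a \in A -> commute z a) -> (forall a, a \in A -> psi a = 0%R) ->
  exists N, forall n, N <= n ->
    exists B, [/\ size B <= 1, exists v, ~ span B v & pinned A n B].
Proof.
move=> F_nonabelian Az z1 zc A0; have [N HN] := level_elliptic (A0 z Az).
exists N => n /HN[z' Ez].
have z'1 : z' <> 1 by move=> E; apply: z1; rewrite Ez E (morph1 (@levelM n)).
exists [:: z']; split=> //.
  apply: contrapT => no; apply: F_nonabelian => u v.
  have S w : powers z' w.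
    by apply/powers_span; apply: contrapT => nw; apply: no; exists w.
  exact: powers_commute (S u) (S v).
move=> f W f1 W1 aW [rW nW].
have Sz : span [:: z'] z' by apply: span_mem; rewrite mem_head.
have Eb : base z' = t ^+ n * z * t ^- n by rewrite Ez /level !gnorm.
apply: (@free_over_centralizer _ _ _ x_basis _ (base f) (base z')).
- move=> a Aa; rewrite Eb.
  have /(congr1 (fun g => t ^+ n * g * t ^- n)) := zc _ Aa.
  by rewrite /commute !gnorm.
(* [f * z'] lies in [W], as [z'] does not, whereas [z' * f] does not lie in [W], as [f] does. *)
- move=> E; have {}E : f * z' = z' * f by apply: (hnn_base_inj phi_inj); rewrite !baseM.
  have Wf : W f by rewrite -[f]mulg1; apply: aW => //; exact: powers_id.
  apply: (rW z' f Sz z'1 Wf); rewrite -E; apply: aW => //; first exact: powers_id.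
  exact: nW.
(* The level k depends on the finite set: [A] need not lie in one level. *)
- move=> s As; have [k Hk] : exists k, forall g, g \in base f :: base z' :: s ->
      exists v, g = level k v.
    apply: level_seq => g; rewrite !inE => /or3P[/eqP->|/eqP->|/As Ag]; rewrite ?hnn_psi_base //.
    by rewrite -(psi_shift n); exact: A0.
  by exists (level k).
Qed.

(** Two elements are used: [h] commutes with the elliptic part of [A] and so forces it into [F],
    while [h0] has the least positive psi, and conjugation by its shift defines [sigma] with image
    [H]. *)
Lemma hyperbolic_pinned (xs : seq X) A h : (forall y, y \in xs) ->
  ~ (forall v, exists u, phi u = v) -> h \in A -> (0 < psi h)%R ->
  (forall a, a \in A -> psi a = 0%R -> commute h a) ->
  exists N, forall n, N <= n ->
    exists B, [/\ size B <= size xs, exists v, ~ span B v & pinned A n B].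
Proof.
move=> xs_all phi_nsurj Ah hp hc.
have [h0 [Ah0 h0p h0min]] : exists h0, [/\ h0 \in A, (0 < psi h0)%R &
    forall b, b \in A -> (0 < psi b)%R -> (psi h0 <= psi b)%R].
  pose P n := `[< exists b, [/\ b \in A, (0 < psi b)%R & psi b = n%:Z%R] >].
  have exP : exists n, P n.
    by exists `|psi h|%N; apply/asboolP; exists h; split=> //; lia.
  case: (ex_minnP exP) => m /asboolP[h0 [Ah0 h0p h0m]] mmin.
  exists h0; split=> // b Ab bp; have : P `|psi b|%N.
    by apply/asboolP; exists b; split=> //; lia.
  by move/mmin; lia.
have [k Ek] : exists k, psi h = k.+1%:Z%R by exists (`|psi h|.-1)%N; lia.
have [m Em] : exists m, psi h0 = m.+1%:Z%R by exists (`|psi h0|.-1)%N; lia.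
have [N1 H1] := hnn_eventually Ek; have [N2 H2] := hnn_eventually Em.
exists (maxn N1 N2) => n; rewrite geq_max => /andP[/H1[u Eu] /H2[w Ew]].
pose sigma v := w * iter m.+1 phi v * w^-1.
have sigmaM : {morph sigma : v v' / v * v'}.
  by move=> v v'; rewrite /sigma iter_phiM !gnorm.
pose H v := exists v', v = sigma v'.
have HM v v' : H v -> H v' -> H (v * v').
  by move=> [y ->] [y' ->]; exists (y * y'); rewrite sigmaM.
have HV v : H v -> H v^-1 by move=> [y ->]; exists y^-1; rewrite (morphV sigmaM).
have H11 : H 1 by exists 1; rewrite (morph1 sigmaM).
have spanH v : span [seq sigma (x y) | y <- xs] v <-> H v.
  split.
    elim=> {v} [//|_ v /mapP[y _ ->] _ Hv|_ v /mapP[y _ ->] _ Hv].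
      by apply: HM => //; exists (x y).
    by apply: HM => //; apply: HV; exists (x y).
  case=> v' ->; rewrite -(redK x_basis v') (morph_word_eval sigmaM).
  elim: (nform x_basis v') => [|a r IH]; first by rewrite word_eval0; exact: span1.
  rewrite word_eval_cons; apply: spanM => //; rewrite word_eval1.
  have S : span [seq sigma (x y) | y <- xs] ((sigma \o x) a.1).
    by apply: span_mem; apply: (map_f (sigma \o x)).
  by case: a.2; [exact: spanV | ].
exists [seq sigma (x y) | y <- xs]; split; first by rewrite size_map.
  (* If [H] were [F], then [phi] iterated m + 1 times would be onto, and so would [phi]. *)
  apply: contrapT => no; apply: phi_nsurj => v.
  have /spanH[y Ey] : span [seq sigma (x y) | y <- xs] (w * v * w^-1).
    by apply: contrapT => nv; apply: no; exists (w * v * w^-1).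
  by exists (iter m phi y); move: Ey => /mulIg/mulgI ->.
move=> f W f1 W1 aW rW.
pose k' := t ^+ n * h * t ^- n; pose k0 := t ^+ n * h0 * t ^- n.
have k'_comm b : shifted A n b -> psi b = 0%R -> commute k' b.
  move=> Ab b0; have := hc _ Ab; rewrite psi_shift => /(_ b0).
  move/(congr1 (fun g => t ^+ n * g * t ^- n)).
  by rewrite /commute /k' !gnorm.
(* The elliptic part is invariant under conjugation by [k0], so [a] is the conjugate by [k0] of an
   element of it, which lies in [F] because it commutes with [k']. *)
have A_ell a : shifted A n a -> psi a = 0%R -> exists2 v, H v & a = base v.
  move=> Aa a0; pose b := k0^-1 * a * k0.
  have Ab : shifted A n b.
    by apply: shiftedM; [apply: shiftedM => //; apply: shiftedV | ]; exact: shiftedK.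
  have b0 : psi b = 0%R by rewrite /b hnn_psiM (hnn_psiM k0^-1) hnn_psiV a0; lia.
  have [v Ev] : exists v, b = base v.
    exact: (@hnn_elliptic_base _ phi u k b k' Eu b0 (k'_comm b Ab b0)).
  exists (sigma v); first by exists v.
  have -> : a = k0 * b * k0^-1 by rewrite /b !gnorm.
  by rewrite Ev /k0 Ew invgM !baseM (morphV baseM) -hnn_conjX !mulgA.
have pos a : shifted A n a -> forall v, (0 < psi a)%R ->
    exists2 v', H v' & a * base v * a^-1 = base v'.
  move=> Aa v ap.
  apply: (@positive_conj _ phi (shifted A n) H k0) => //.
  - by move=> *; exact: shiftedM.
  - by move=> *; exact: shiftedV.
  - exact: shiftedK.
  - by rewrite /k0 psi_unshift.
  - by move=> b Ab; rewrite /k0 psi_unshift -(psi_shift n b); exact: h0min.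
  - move=> v'; exists (sigma v'); first by exists v'.
    by rewrite /k0 Ew invgM !baseM (morphV baseM) -hnn_conjX !mulgA.
apply: (@free_over_hyperbolic _ _ phi_inj f W H) => //.
- by move=> *; exact: shiftedM.
- by move=> *; exact: shiftedV.
- by case: rW => r1 r2; split=> [v g /spanH|v /spanH]; [exact: r1 | exact: r2].
- by move=> a v Aa ap; exact: pos.
Qed.

(** If [z] is elliptic, any hyperbolic [h] will do: [a] and [h * a * h^-1] lie in the locally cyclic
    centralizer of [z], some power [a ^+ q] is a power of [z] and so commutes with [h], and q-th
    roots are unique among commuting elements. *)
Lemma centre_hyperbolic A z b : z \in A -> z <> 1 ->
  (forall a, a \in A -> commute z a) -> b \in A -> psi b <> 0%R ->
  exists2 h, h \in A & (0 < psi h)%R /\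
    forall a, a \in A -> psi a = 0%R -> commute h a.
Proof.
move=> Az z1 zc.
have posit c : c \in A -> psi c <> 0%R -> exists2 h, h \in A &
    (0 < psi h)%R /\ (h = c \/ h = c^-1).
  move=> Ac c0; have [cp|cn] := boolP (0 < psi c)%R.
    by exists c => //; split=> //; left.
  by exists c^-1; [exact: gpredVr | split; [rewrite hnn_psiV; lia | right]].
have [z0|/eqP z0] := eqVneq (psi z) 0%R; last first.
  have [h Ah [hp hz]] := posit z Az z0; exists h => //; split=> // a Aa _.
  by case: hz => ->; [exact: zc | apply/commute_sym/commuteV/commute_sym/zc].
move=> Ab /(posit b Ab)[h Ah [hp _]]; exists h => //; split=> // a Aa a0.
pose a' := h * a * h^-1.
have Aa' : a' \in A by rewrite gpredM ?gpredVr // gpredM.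
have [n Hn] : exists n, forall g, g \in [:: z; a; a'] -> exists v, g = level n v.
  by apply: level_seq => g; rewrite !inE => /or3P[] /eqP-> //; rewrite /a' hnn_psiJ.
have [z' Ez] := Hn z (mem_head _ _).
have [v Ev] : exists v, a = level n v by apply: Hn; rewrite !inE eqxx orbT.
have [v' Ev'] : exists v, a' = level n v by apply: Hn; rewrite !inE eqxx !orbT.
have z'1 : z' <> 1 by move=> E; apply: z1; rewrite Ez E (morph1 (@levelM n)).
have vz : commute v z'.
  by apply: (@level_inj n); rewrite !levelM -Ez -Ev; apply/esym/zc.
have vz' : commute v' z'.
  by apply: (@level_inj n); rewrite !levelM -Ez -Ev'; apply/esym/zc.
have [|w [wz ws]] := @commuting_seq_cyclic _ _ _ x_basis z' [:: v; v'] z'1.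
  by move=> g; rewrite !inE => /orP[] /eqP->.
have wv : powers w v by apply: ws; rewrite mem_head.
have wv' : powers w v' by apply: ws; rewrite !inE eqxx orbT.
(* If z' is w^q and v is w^p up to sign of the exponents, then v^q is a power of z' with exponent p
   up to sign. *)
have [q q0 vq] : exists2 q, 0 < q & powers z' (v ^+ q).
  case: wz => [[|q] zE]; first by case: z'1; case: zE => ->; rewrite ?invg1.
  exists q.+1 => //; case: wv => p vE.
  have wq : powers z' (w ^+ q.+1).
    case: zE => ->; first exact: powers_id.
    by have := powersV (powers_id (w ^- q.+1)); rewrite invgK.
  apply: powers_trans wq _; exists p.
  by case: vE => ->; [left | right]; rewrite ?expVgn -!expgnA mulnC.
have haq : commute h (a ^+ q).
  have : powers z (a ^+ q).
    case: vq => p vqE; exists p; rewrite Ev Ez -!(morphX (@levelM n)) -(morphV (@levelM n)).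
    by case: vqE => ->; [left | right].
  have hz : commute h z by apply/esym/zc.
  by case=> p [] ->; [exact: commuteX | exact/commuteV/commuteX].
have Evv : v' = v.
  apply: (free_root_unique x_basis q0); first exact: powers_commute wv' wv.
  apply: (@level_inj n); rewrite !(morphX (@levelM n)) -Ev -Ev' /a'.
  have -> : (h * a * h^-1) ^+ q = h * a ^+ q * h^-1.
    have := conjXg a h^-1 q; rewrite !conjgE invgK !mulgA => <-.
    by [].
  by rewrite haq mulgK.
by apply: (mulIg h^-1); rewrite mulgK -/a' Ev' Evv -Ev.
Qed.

End Main.

Theorem proposition5p9 (F : groupType)
    (F_free : is_free_group F) (F_fg : finitely_generated F)
    (F_nonabelian : ~ (forall x y : F, commute x y))
    (phi : {multiplicative F -> F})
    (phi_inj : injective phi) (phi_nsurj : ~ (forall y, exists x, phi x = y))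
    (s : nat) (A : 'I_s -> groupClosed (hnn phi))
    (A_centre : forall i, nontrivial_centre (A i)) :
  exists f : hnn phi,
    [/\ elliptic f, infinite_order f &
        forall i, naturally_free_product (cyclic_subgroup f) (A i)].
Proof.
have [X [x x_basis]] := F_free.
have [xs [xs_uniq xs_all]] := finitely_generated_basis x_basis F_fg.
have [c [d cd]] := nonabelian_basis x_basis F_nonabelian.
have xs2 : 1 < size xs.
  have /uniq_leq_size -> // : uniq [:: c; d] by rewrite /= inE cd.
have pin i : exists N, forall n, N <= n -> exists B : seq F,
    [/\ size B <= size xs, exists v, ~ span B v & pinned (A i) n B].
  have [z [Az z1 zc]] := A_centre i.
  have [A0|nA0] := pselect (forall a, a \in A i -> hnn_psi a = 0%R).
    have [N HN] := elliptic_pinned x_basis phi_inj F_nonabelian Az z1 zc A0.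
    exists N => n /HN[B [sB nB pB]]; exists B; split=> //.
    exact: leq_trans sB (ltnW xs2).
  have [b Ab b0] : exists2 b, b \in A i & hnn_psi b <> 0%R.
    apply: contrapT => no; apply: nA0 => a Aa; apply: contrapT => a0.
    by apply: no; exists a.
  have [h Ah [hp hc]] := centre_hyperbolic x_basis phi_inj Az z1 zc Ab b0.
  exact: (hyperbolic_pinned x_basis phi_inj xs_all phi_nsurj Ah hp hc).
have [N HN] := choice pin.
pose n := \max_(i < s) N i.
have [B HB] := choice (fun i => HN i n (leq_bigmax i)).
have [|f [W [f1 W1 aW rW]]] := @ping_pong_element _ _ _ x_basis [seq B i | i <- enum 'I_s] c d cd.
  move=> _ /mapP[i _ ->]; have [sB nB _] := HB i.
  exact: (not_covered x_basis xs_uniq xs_all xs2 sB nB).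
(* [f] was found for the subgroups conjugated by t^n; [g] undoes this conjugation. *)
pose t := hnn_stable phi; pose g := t ^- n * hnn_base phi f * t ^+ n.
have gM : {morph (fun k => t ^- n * k * t ^+ n) : k l / k * l}.
  by move=> k l; rewrite !gnorm.
have gX m : g ^+ m = t ^- n * hnn_base phi (f ^+ m) * t ^+ n.
  by rewrite (morphX (@hnn_baseM F phi)) -(morphX gM).
exists g; split.
- by rewrite /elliptic /g !hnn_psiM hnn_psiV hnn_psi_base; lia.
- move=> m m0; rewrite gX => E; apply: f1.
  apply: (free_torsion_free x_basis m0); apply: (hnn_base_inj phi_inj).
  apply: (@mulgI _ (t ^- n)); apply: (@mulIg _ (t ^+ n)); rewrite E.
  by rewrite (morph1 (@hnn_baseM F phi)) mulg1 mulVg.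
- move=> i; apply: free_over_natural; have [_ _ pB] := HB i.
  have fr := pB f W f1 W1 aW (rW _ (map_f B (mem_enum _ i))).
  have inj : injective (fun k => t ^- n * k * t ^+ n) by move=> k l /mulIg/mulgI.
  apply: free_over_sub (free_over_image gM inj fr) => k.
    move=> [m kE]; case: kE => ->; rewrite gX.
      by exists (hnn_base phi f ^+ m); [exists m; left | rewrite (morphX (@hnn_baseM F phi))].
    exists (hnn_base phi f ^- m); first by exists m; right.
    by rewrite (morphX (@hnn_baseM F phi)) -(morphV gM).
  move=> Ak; exists (t ^+ n * k * t ^- n); last by rewrite !gnorm.
  by rewrite !gnorm.
Qed.
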